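(* Let $1/2<d<1$, let $(\varepsilon_i)_{i\in\mathbb{Z}}$ be i.i.d. real random variables with mean $0$, variance $1$ and $\mathbb{E}\varepsilon_1^4<\infty$, and let $X_n$ be the Type I non-stationary process $$X_n=X_0+\sum_{j=1}^nY_j,\qquad Y_j=\sum_{i=0}^\infty a_i\varepsilon_{j-i},\qquad a_i=\frac{\Gamma(i+d-1)}{\Gamma(i+1)\Gamma(d-1)},$$ with $X_0=0$. Then $X_n^2$ is asymptotically LM$(d)$.
   Context: For $\delta<1/2$, a stationary time series is called LM$(\delta)$ if its spectral density $f$ behaves like the power function $|\lambda|^{-2\delta}$ at low frequencies, i.e. $f(\lambda)\sim c|\lambda|^{-2\delta}$ as $\lambda\to0$ for some constant $0<c<\infty$. For $\delta\ge1/2$, a time series $W_n$ is LM$(\delta)$ if and only if $(1-B)^mW_n$ is LM$(\delta-m)$ for $m=[\delta+1/2]$, where $[x]$ is the largest integer smaller than or equal to $x$ and $B$ is the backward shift, $BW_n=W_{n-1}$. In particular, for $1/2<d<1$, LM$(d)$ refers to the first difference $W_n-W_{n-1}$ being LM$(d-1)$. For $1/2<d<1$, a (non-stationary) process $W_n$ is asymptotically LM$(d)$ if its first difference $D_n=W_n-W_{n-1}$ behaves, in terms of autocorrelation, asymptotically as a stationary LM$(d-1)$ process: for every integer $h\ge0$ the limit $\rho(h)=\lim_{n\to\infty}\mathrm{Corr}(D_n,D_{n+h})$ exists, and $\rho$ is the autocorrelation function of a stationary LM$(d-1)$ process. *)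

(* Defs.v *)
From mathcomp Require Import all_boot all_order all_algebra finmap.
From mathcomp Require Import all_classical all_reals all_analysis.

Set Implicit Arguments.
Unset Strict Implicit.
Unset Printing Implicit Defensive.

Import Order.TTheory GRing.Theory Num.Theory.
Import numFieldNormedType.Exports.

Local Open Scope classical_set_scope.
Local Open Scope ring_scope.

(* Euler's integral; only meaningful for x > 0. *)
Definition euler_gamma (R : realType) (x : R) : R :=
  \int[lebesgue_measure]_(t in `]0, +oo[) (t `^ (x - 1) * expR (- t)).

(* n := truncn (1 - x) is the least natural number with 0 < x + n (so n = 0
   when x > 0), and Gamma is extended to the left by
   Gamma (x + n) = x (x + 1) ... (x + n - 1) Gamma x.
   At the poles 0, -1, -2, ... the product vanishes and Gamma x = 0. *)
Definition Gamma (R : realType) (x : R) : R :=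
  let n := Num.truncn (1 - x) in
  euler_gamma (x + n%:R) / \prod_(k < n) (x + k%:R).

Definition frac_coef (R : realType) (d : R) (i : nat) : R :=
  Gamma (i%:R + d - 1) / (Gamma (i%:R + 1) * Gamma (d - 1)).

Definition mutually_independent (disp : measure_display)
    (T : measurableType disp) (R : realType) (P : probability T R)
    (I : choiceType) (X : I -> T -> R) : Prop :=
  forall (J : {fset I}) (B : I -> set R),
    (forall i, measurable (B i)) ->
    P (\bigcap_(i in [set` J]) (X i @^-1` B i)) =
    (\prod_(i <- J) P (X i @^-1` B i))%E.

Definition identically_distributed (disp : measure_display)
    (T : measurableType disp) (R : realType) (P : probability T R)
    (I : Type) (X : I -> T -> R) : Prop :=
  forall (i j : I) (B : set R), measurable B ->
    P (X i @^-1` B) = P (X j @^-1` B).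

(* The moving average Y_j = \sum_i a_i eps_(j - i), the series being understood
   in the almost sure sense; Y may be any version of its sum. *)
Definition linear_process (disp : measure_display)
    (T : measurableType disp) (R : realType) (P : probability T R)
    (a : nat -> R) (eps Y : int -> T -> R) : Prop :=
  forall j : int, {ae P, forall w,
    series (fun i : nat => a i * eps (j - i%:Z) w) @ \oo --> Y j w}.

Definition corr (disp : measure_display) (T : measurableType disp)
    (R : realType) (P : probability T R) (U V : T -> R) : R :=
  fine (covariance P U V) /
  (Num.sqrt (fine 'V_P[U]) * Num.sqrt (fine 'V_P[V])).

(* Stationarity is in the second-order (wide) sense. *)
Definition stationary (disp : measure_display) (T : measurableType disp)
    (R : realType) (P : probability T R) (W : int -> T -> R) : Prop :=
  [/\ forall n, W n \in Lfun P 2%:E,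
      forall n, ('E_P[W n] = 'E_P[W 0%R])%E &
      forall n h, covariance P (W n) (W (n + h)) = covariance P (W 0) (W h)].

(* Real and imaginary parts of
   Cov (W_0, W_h) = \int_(-pi)^pi exp (i h l) f l dl. *)
Definition spectral_density (disp : measure_display) (T : measurableType disp)
    (R : realType) (P : probability T R) (W : int -> T -> R) (f : R -> R) :
    Prop :=
  let mu := @lebesgue_measure R in
  let D : set R := `[- pi, pi]%classic in
  [/\ forall l, D l -> 0 <= f l,
      mu.-integrable D (EFin \o f),
      forall h : int, covariance P (W 0) (W h) =
        (\int[mu]_(l in D) (cos (h%:~R * l) * f l))%:E &
      forall h : int, \int[mu]_(l in D) (sin (h%:~R * l) * f l) = 0].

(* Spectral densities are only determined almost everywhere, hence the
   existential quantifier over f. *)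
Definition stationary_LM (disp : measure_display) (T : measurableType disp)
    (R : realType) (P : probability T R) (delta : R) (W : int -> T -> R) :
    Prop :=
  [/\ delta < 2^-1, stationary P W &
      exists2 f : R -> R, spectral_density P W f &
      exists2 c : R, 0 < c &
        f ~_(0^') (fun l : R => c * `|l| `^ (- (2 * delta)))].

(* The stationary process may live on any probability space. *)
Definition LM_autocorrelation (R : realType) (delta : R) (rho : nat -> R) :
    Prop :=
  exists (disp : measure_display) (T : measurableType disp)
         (P : probability T R) (W : int -> T -> R),
    stationary_LM P delta W /\ forall h : nat, rho h = corr P (W 0) (W h%:Z).

(* Only the values for n >= 1 are genuine differences; the one at 0 is 0. *)
Definition first_diff (T : Type) (R : realType) (W : nat -> T -> R) (n : nat) :
    T -> R :=
  fun w => W n w - W n.-1 w.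

(* Square integrability of the differences is what makes their correlations
   meaningful. *)
Definition asymptotically_LM (disp : measure_display)
    (T : measurableType disp) (R : realType) (P : probability T R)
    (d : R) (W : nat -> T -> R) : Prop :=
  (forall n, first_diff W n \in Lfun P 2%:E) /\
  exists rho : nat -> R,
    (forall h : nat,
       corr P (first_diff W n) (first_diff W (n + h)) @[n --> \oo] --> rho h) /\
    LM_autocorrelation (d - 1) rho.

(* Main.v *)
Require Import Defs.
From mathcomp Require Import all_boot all_order all_algebra finmap.
From mathcomp Require Import all_classical all_reals all_analysis.
From mathcomp Require Import measurable_realfun zify ring lra.

Set Implicit Arguments.
Unset Strict Implicit.
Unset Printing Implicit Defensive.

Import Order.TTheory GRing.Theory Num.Theory.
Import numFieldNormedType.Exports.

Local Open Scope classical_set_scope.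
Local Open Scope ring_scope.

(** Put al = 1 - d, so that 0 < al < 1/2 and the a_i are the Taylor coefficients
    of (1 - z)^al, and let S_n = X_n + X_(n-1).  Then

      D_n = X_n^2 - X_(n-1)^2 = Y_n S_n,

    a product of two linear forms in the innovations.  The fourth moment of
    linear forms in independent variables is a sum over the three pairings of
    the factors plus a multiple of the fourth cumulant ([lin_moment4]), so

      Cov (D_n, D_m) = gamma (m - n) E[S_n S_m] + E[Y_n S_m] E[S_n Y_m]
                       + kappa (Y_n, S_n, Y_m, S_m),

    with gamma the autocovariance of Y.  The last two terms are bounded, because
    \sum |a_i| <= 2 and each weight of an innovation in X_n is a sum of distinct
    a_i ([covD_approx]).  The first one dominates: replacing n, m by nearby
    indices changes E[S_n S_m] by a bounded amount ([covS_shift]), while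
    E[S_n^2] >= b_0^2 + ... + b_(n-1)^2 with b_k = a_0 + ... + a_k, and this
    tends to infinity since b_k^2 >= (1 - al)^2 / (k + 1) for al < 1/2
    ([covS_cvgy]); this is where d > 1/2 is used.  Dividing by E[S_n^2],

      Corr (D_n, D_(n+h)) --> gamma (h) / gamma (0),

    the autocorrelation of Y itself ([corr_prodYS_cvg]).

    It remains to see that Y is LM(d - 1).  Its spectral density should be
    (2 pi)^-1 |A (e^(il))|^2 with A (z) = (1 - z)^al = \sum a_i z^i, that is,
    (2 pi)^-1 (2 - 2 cos l)^al, which is equivalent to (2 pi)^-1 |l|^(2 al) at 0.
    For the partial sums A_N, the Fourier coefficients of |A_N (e^(il))|^2 are
    the autocovariances of the truncated process ([Rintegral_cos_transfer_sqr]),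
    and dominated convergence passes to the limit as soon as
    |A_N (e^(il))|^2 --> (2 - 2 cos l)^al for l <> 0 ([transfer_sqr_cvg]).  This
    convergence on the unit circle is obtained without complex powers: A_N
    satisfies the differential equation of (1 - z)^al up to a small remainder,
    so |A_N|^2 |1 - z|^(-2 al) is almost constant along the radius from 0 to
    e^(il).

    Probabilistic limits are taken in the same way: Y_j is approximated by the
    finite forms \sum_(i < N) a_i eps_(j - i), dominated in fourth power by an
    integrable function ([approx4_yform]), and all moments up to order four
    converge ([approx4_cvg]).  Finally, that the Gamma quotients defining the
    a_i are the binomial products ([frac_coefE]) follows from the functional
    equation and positivity of Euler's integral. *)

(** * Coefficients of a fractional difference *)

Section coefficients.
Variables (R : realType) (al : R).
Hypotheses (al_gt0 : 0 < al) (al_lt : al < 2^-1).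

(** The coefficient of z^k in (1 - z)^al. *)
Definition binom_coef (k : nat) : R :=
  \prod_(i < k) ((i%:R - al) / i.+1%:R).

(** The coefficient of z^n in (1 - z)^(al - 1), so that multiplication by
    (1 - z)^-1, i.e. summation, carries [binom_coef] to it. *)
Definition binom_psum (n : nat) : R := \prod_(i < n) (1 - al / i.+1%:R).

(** All coefficients after the first are negative: this is what makes their
    absolute sum telescope. *)
Lemma binom_coefS k : binom_coef k.+1 = - (al / k.+1%:R) * binom_psum k.
Proof.
elim: k => [|k IH].
  by rewrite /binom_coef /binom_psum big_ord0 big_ord_recr big_ord0 /=; lra.
rewrite /binom_coef big_ord_recr /= -/(binom_coef k.+1) IH.
rewrite [in RHS]/binom_psum big_ord_recr /= -/(binom_psum k).
have h1 : k.+1%:R != 0 :> R by rewrite pnatr_eq0.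
have h2 : k.+2%:R != 0 :> R by rewrite pnatr_eq0.
rewrite -[k.+2%:R]natr1; by field; rewrite nat1r natr1 h1 h2.
Qed.

Lemma sum_binom_coef n : \sum_(i < n.+1) binom_coef i = binom_psum n.
Proof.
elim: n => [|n IH].
  by rewrite big_ord_recr big_ord0 /= add0r /binom_coef /binom_psum !big_ord0.
by rewrite big_ord_recr /= IH binom_coefS /binom_psum big_ord_recr /=; ring.
Qed.

Let al_lt1 : al < 1. Proof. by move: al_lt; lra. Qed.

Lemma factor_bounds k : 0 < 1 - al / k.+1%:R <= 1.
Proof.
have h : 0 < k.+1%:R :> R by rewrite ltr0n.
rewrite lerBlDr lerDl divr_ge0 ?ltW// andbT subr_gt0 ltr_pdivrMr // mul1r.
by apply: (@lt_le_trans _ _ 1); [exact: al_lt1 | rewrite ler1n].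
Qed.

Lemma binom_psum_gt0 n : 0 < binom_psum n.
Proof. by apply: prodr_gt0 => i _; case/andP: (factor_bounds i). Qed.

Lemma binom_psumS_le n : binom_psum n.+1 <= binom_psum n.
Proof.
rewrite {1}/binom_psum big_ord_recr /= ler_piMr ?(ltW (binom_psum_gt0 n))//.
by case/andP: (factor_bounds n).
Qed.

Lemma binom_psum_anti m n : (m <= n)%N -> binom_psum n <= binom_psum m.
Proof.
elim: n => [|n IH]; first by rewrite leqn0 => /eqP ->.
rewrite leq_eqVlt => /orP[/eqP -> //|/IH]; apply: le_trans.
exact: binom_psumS_le.
Qed.

(** As only the zeroth coefficient is positive, the absolute sum is twice it
    minus the partial sum, and the partial sums are positive. *)
Lemma sum_norm_binom_coef n : \sum_(i < n) `|binom_coef i| <= 2.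
Proof.
have key m : \sum_(i < m.+1) `|binom_coef i| = 2 - binom_psum m.
  elim: m => [|m IH].
    rewrite big_ord_recr big_ord0 /= add0r /binom_coef /binom_psum !big_ord0.
    by rewrite normr1; lra.
  rewrite big_ord_recr /= IH binom_coefS mulNr normrN ger0_norm.
    by rewrite /binom_psum big_ord_recr /=; ring.
  by rewrite mulr_ge0 ?divr_ge0 ?ltW// binom_psum_gt0.
case: n => [|n]; first by rewrite big_ord0.
by rewrite key; have := binom_psum_gt0 n; lra.
Qed.

(** The product k b_k^2 is nondecreasing for k >= 1, because
    (1 - al / x)^2 >= 1 - 2 al / x >= 1 - 1 / x; this needs al < 1/2. *)
Lemma binom_psum_sqr_ge k : (1 - al) ^+ 2 / k.+1%:R <= binom_psum k ^+ 2.
Proof.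
have key n : (1 - al) ^+ 2 <= n.+1%:R * binom_psum n.+1 ^+ 2.
  elim: n => [|n IH].
    by rewrite /binom_psum big_ord_recr big_ord0 /= mul1r divr1 mul1r.
  apply: (le_trans IH).
  rewrite [in leRHS]/binom_psum big_ord_recr /= -/(binom_psum n.+1).
  rewrite exprMn [leRHS]mulrCA [leLHS]mulrC ler_wpM2l ?sqr_ge0//.
  have h : 0 < n.+2%:R :> R by rewrite ltr0n.
  have -> : n.+1%:R = n.+2%:R - 1 :> R by rewrite -[n.+2%:R]natr1; ring.
  move: h; set x := n.+2%:R => h.
  have -> : x * (1 - al / x) ^+ 2 = x - 2 * al + al ^+ 2 / x.
    by field; rewrite gt_eqF.
  have : 0 <= al ^+ 2 / x by rewrite divr_ge0 ?sqr_ge0 ?ltW.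
  by move: (al ^+ 2 / x) al_lt => y; lra.
case: k => [|k].
  rewrite /binom_psum big_ord0 divr1 !expr2; move: al_gt0 al_lt; nra.
have h : 0 < k.+2%:R :> R by rewrite ltr0n.
rewrite ler_pdivrMr // mulrC; apply: (le_trans (key k)).
by rewrite ler_wpM2r ?sqr_ge0// ler_nat.
Qed.

Lemma harmonic_sum_unbounded (M : R) :
  exists N, forall n, (N <= n)%N -> M <= \sum_(k < n) k.+1%:R^-1.
Proof.
have nd : nondecreasing_seq (series (@harmonic R)).
  by apply: nondecreasing_series => k _ _; exact: harmonic_ge0.
have := nondecreasing_dvgn_lt nd (@dvg_harmonic R).
move=> /cvgryPge /(_ M) [N _ HN]; exists N => n /HN /=.
by rewrite /series /= big_mkord.
Qed.

Lemma sum_binom_psum_sqr_cvgy :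
  \sum_(k < n) binom_psum k ^+ 2 @[n --> \oo] --> +oo.
Proof.
apply/cvgryPge => M.
have p : 0 < (1 - al) ^+ 2 by rewrite exprn_gt0// subr_gt0 al_lt1.
have [N HN] := harmonic_sum_unbounded (M / (1 - al) ^+ 2).
exists N => // n /= /HN; rewrite ler_pdivrMr // => /le_trans; apply.
rewrite mulr_suml; apply: ler_sum => k _; rewrite mulrC.
exact: binom_psum_sqr_ge.
Qed.

(** A decreasing b with positive limit would give |a_k| = (al / k) b_(k-1) a
    divergent sum. *)
Lemma binom_psum_cvg0 : binom_psum n @[n --> \oo] --> 0.
Proof.
apply/cvgr0Pnorm_le => e e0.
have [N HN] := harmonic_sum_unbounded ((al * e)^-1).
exists N => // n /= /HN h.
rewrite gtr0_norm ?binom_psum_gt0//.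
have s : al * binom_psum n * \sum_(k < n) k.+1%:R^-1 <= 1.
  rewrite -(lerD2l 1) -[leRHS]/2; apply: le_trans (sum_norm_binom_coef n.+1).
  rewrite big_ord_recl {1}/binom_coef big_ord0 normr1 lerD2l mulr_sumr.
  apply: ler_sum => k _; rewrite lift0 binom_coefS mulNr normrN.
  rewrite ger0_norm ?mulr_ge0 ?divr_ge0 ?(ltW al_gt0) ?(ltW (binom_psum_gt0 _))//.
  rewrite -!mulrA ler_pM2l// mulrC ler_pM2l ?invr_gt0//.
  by apply: binom_psum_anti; rewrite ltnW.
have ae : 0 < al * e by rewrite mulr_gt0.
have : al * binom_psum n * (al * e)^-1 <= 1.
  apply: le_trans s; rewrite ler_wpM2l// mulr_ge0 ?(ltW al_gt0)//.
  exact/ltW/binom_psum_gt0.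
by rewrite ler_pdivrMr// mul1r ler_pM2l.
Qed.

End coefficients.

(** * Euler's integral and the Gamma quotients *)

Section euler_integral.
Variable R : realType.
Local Notation mu := (@lebesgue_measure R).

Definition euler_kernel (x t : R) : R := t `^ (x - 1) * expR (- t).

(** Euler's integral as an extended real, so that its finiteness can be derived
    from the functional equation. *)
Definition euler_int (x : R) : \bar R :=
  (\int[mu]_(t in `]0%R, +oo[) (euler_kernel x t)%:E)%E.

Lemma euler_kernel_ge0 x t : 0 <= euler_kernel x t.
Proof. by rewrite mulr_ge0 ?powR_ge0 ?expR_ge0. Qed.

Lemma measurable_euler_kernel x D : measurable_fun D (euler_kernel x).
Proof.
apply: measurable_funTS; apply: measurable_funM.
  exact: measurable_powR.
apply: measurableT_comp => //.
Qed.

(** Integration by parts is carried out on compact intervals away from 0, which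
    exhaust the half-line. *)
Let F (n : nat) : set R := `[n.+1%:R^-1, n.+2%:R]%classic.

Let Fle n : n.+1%:R^-1 < n.+2%:R :> R.
Proof.
apply: (@le_lt_trans _ _ 1); last by rewrite ltr1n.
by rewrite invf_le1 ?ler1n// ltr0n.
Qed.

Let F_gt0 n t : F n t -> 0 < t.
Proof.
by rewrite /F /= in_itv /= => /andP[h _]; apply: lt_le_trans h; rewrite invr_gt0.
Qed.

Let bigcup_F : \bigcup_n F n = `]0, +oo[%classic.
Proof.
apply/seteqP; split => [t [n _ /F_gt0]|t]; rewrite /= in_itv /= ?andbT //.
move=> t0; exists (maxn (Num.truncn t) (Num.truncn t^-1)) => //.
rewrite /F /= in_itv /=; apply/andP; split.
  rewrite -[leRHS]invrK lef_pV2 ?posrE ?ltr0n ?invr_gt0//.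
  apply/ltW/(lt_le_trans (truncnS_gt _)).
  by rewrite ler_nat ltnS leq_maxr.
apply/ltW/(lt_le_trans (truncnS_gt _)).
by rewrite ler_nat ltnS leqW// leq_maxl.
Qed.

Let cvg_F (f : R -> R) : measurable_fun setT f -> (forall t, 0 <= f t) ->
  (\int[mu]_(t in F n) (f t)%:E)%E @[n --> \oo] -->
  (\int[mu]_(t in `]0%R, +oo[) (f t)%:E)%E.
Proof.
move=> mf f0; rewrite -bigcup_F; apply: ge0_nondecreasing_set_cvg_integral => //.
- apply/nondecreasing_seqP => n; apply/subsetPset => t.
  rewrite /F /= !in_itv /= => /andP[h1 h2]; apply/andP; split.
    by apply: le_trans h1; rewrite lef_pV2 ?posrE ?ltr0n// ler_nat.
  by apply: (le_trans h2); rewrite ler_nat.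
- by move=> n; exact: measurable_itv.
- by move=> n; apply/measurable_EFinP; apply: measurable_funTS.
- by move=> n t _; rewrite lee_fin.
Qed.

Let bdry (x t : R) := t `^ x * expR (- t).

Let bdryE x t : bdry x t = euler_kernel (x + 1) t.
Proof. by rewrite /bdry /euler_kernel addrK. Qed.

Let int_F_by_parts x n :
  (\int[mu]_(t in F n) (x * euler_kernel x t)%:E =
   \int[mu]_(t in F n) (euler_kernel (x + 1) t)%:E +
   (bdry x n.+2%:R - bdry x n.+1%:R^-1)%:E)%E.
Proof.
have cE t : {for t, continuous (fun t : R => expR (- t))}.
  apply: continuous_comp; first exact: opp_continuous.
  exact: continuous_expR.
have dE t : derivable (fun t : R => expR (- t)) t 1.
  exact: ex_derive.
have dE' t : (fun t : R => expR (- t))^`()%classic t = - expR (- t).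
  by rewrite derive1E; apply: derive_val; apply: is_derive_eq; rewrite mulrN1.
have cP y t : 0 < t -> {for t, continuous (@powR R ^~ y)}.
  move=> t0; apply: differentiable_continuous; apply/derivable1_diffP.
  by apply: derivable_powR; rewrite in_itv /= t0.
have itv0 (t : R) : t \in `]n.+1%:R^-1, n.+2%:R[ -> 0 < t.
  by rewrite in_itv /= => /andP[h _]; apply: lt_trans h; rewrite invr_gt0.
have wc (f : R -> R) : (forall t, 0 < t -> {for t, continuous f}) ->
    {within `[n.+1%:R^-1, n.+2%:R], continuous f}.
  move=> cf; apply: continuous_in_subspaceT => t.
  by rewrite inE => /F_gt0; exact: cf.
have lr (f : R -> R) : (forall t, 0 < t -> derivable f t 1) ->
    derivable_oo_LRcontinuous f n.+1%:R^-1 n.+2%:R.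
  move=> df; split.
  - by move=> t /itv0; exact: df.
  - apply: cvg_at_right_filter; apply: differentiable_continuous.
    by apply/derivable1_diffP/df; rewrite invr_gt0.
  - apply: cvg_at_left_filter; apply: differentiable_continuous.
    by apply/derivable1_diffP/df.
have : (\int[mu]_(t in F n) (t `^ x * - expR (- t))%:E =
    (bdry x n.+2%:R - bdry x n.+1%:R^-1)%:E -
    \int[mu]_(t in F n) (x * t `^ (x - 1) * expR (- t))%:E)%E.
  apply: integration_by_parts => //.
  - apply: wc => t t0; apply: (@continuousM R R); first exact: cst_continuous.
    exact: cP.
  - by apply: lr => t t0; apply: derivable_powR; rewrite in_itv /= t0.
  - by move=> t /itv0 t0; rewrite powR_derive1// in_itv /= t0.
  - by apply: wc => t _; apply: continuousN; exact: cE.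
  - exact: lr.
have -> : (\int[mu]_(t in F n) (t `^ x * - expR (- t))%:E =
   - \int[mu]_(t in F n) (euler_kernel (x + 1) t)%:E)%E.
  rewrite -integral_ge0N /=; last by move=> t _; rewrite lee_fin euler_kernel_ge0.
  by apply: eq_integral => t _; rewrite mulrN EFinN -bdryE.
have -> : (\int[mu]_(t in F n)
     (x * t `^ (x - 1) * expR (- t))%:E =
   \int[mu]_(t in F n) (x * euler_kernel x t)%:E)%E.
  by apply: eq_integral => t _; rewrite mulrA.
set A := integral _ _ _; set B := integral _ _ _.
have : (0 <= A)%E by apply: integral_ge0 => t _; rewrite lee_fin euler_kernel_ge0.
by case: A B => [a| |] [b| |] //= _ [] e; congr EFin; lra.
Qed.

(** The exponential beats t^x by its Taylor term of order m + 1 > x. *)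
Let bdry_cvg0y x : 0 < x -> bdry x n.+2%:R @[n --> \oo] --> 0.
Proof.
move=> x0; set m := (Num.truncn x).+1.
apply: (@squeeze_cvgr _ _ _ _ (fun=> 0) (fun n => m.+1`!%:R * n.+1%:R^-1)).
- near=> n; rewrite mulr_ge0 ?powR_ge0 ?expR_ge0//=.
  set t : R := n.+2%:R; have t1 : 1 <= t by rewrite ler1n.
  have t0 : 0 < t by apply: lt_le_trans t1.
  apply: (@le_trans _ _ (m.+1`!%:R * t^-1)); last first.
    by rewrite ler_pM2l ?ltr0n ?fact_gt0// lef_pV2 ?posrE// ler_nat.
  have fact0 : 0 < m.+1`!%:R :> R by rewrite ltr0n fact_gt0.
  have h1 : t `^ x <= t ^+ m.
    rewrite -powR_mulrn ?(ltW t0)//; apply: ler_powR => //.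
    exact/ltW/truncnS_gt.
  have h2 : t ^+ m.+1 / m.+1`!%:R <= expR t.
    by apply: le_trans (expR_ge1Dxn m (ltW t0)); rewrite lerDr.
  rewrite /bdry expRN ler_pdivrMr ?expR_gt0//; apply: (le_trans h1).
  have -> : t ^+ m = m.+1`!%:R / t * (t ^+ m.+1 / m.+1`!%:R).
    by rewrite exprS; field; rewrite !gt_eqF.
  by rewrite ler_pM2l// divr_gt0.
- exact: cvg_cst.
- rewrite -[X in _ --> X](mulr0 m.+1`!%:R); apply: cvgMr.
  exact: cvg_harmonic.
Unshelve. all: by end_near. Qed.

Let bdry_cvg00 x : 0 < x -> bdry x n.+1%:R^-1 @[n --> \oo] --> 0.
Proof.
move=> x0.
apply: (@squeeze_cvgr _ _ _ _ (fun=> 0) (fun n => n.+1%:R^-1 `^ x)).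
- near=> n; rewrite mulr_ge0 ?powR_ge0 ?expR_ge0//=.
  by rewrite ler_piMr ?powR_ge0// expR_le1 oppr_le0 invr_ge0.
- exact: cvg_cst.
- have := (cvg_at_rightP (fun a : R => a `^ x) 0 0).1 (powR_cvg0 x0).
  by apply; split; [move=> n; rewrite invr_gt0 | exact: cvg_harmonic].
Unshelve. all: by end_near. Qed.

Lemma euler_intS x : 0 < x -> euler_int (x + 1) = (x%:E * euler_int x)%E.
Proof.
move=> x0.
have c1 := cvg_F (@measurable_euler_kernel (x + 1) setT)
  (euler_kernel_ge0 (x + 1)).
have c2 : (\int[mu]_(t in F n) (x * euler_kernel x t)%:E)%E @[n --> \oo] -->
    (\int[mu]_(t in `]0%R, +oo[) (x * euler_kernel x t)%:E)%E.
  apply: cvg_F.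
    by apply: measurable_funM => //; exact: measurable_euler_kernel.
  by move=> t; rewrite mulr_ge0 ?euler_kernel_ge0// ltW.
have e : (\int[mu]_(t in `]0%R, +oo[) (x * euler_kernel x t)%:E =
   x%:E * euler_int x)%E.
  rewrite /euler_int -ge0_integralZl_EFin ?ltW//.
  - by move=> t _; rewrite lee_fin euler_kernel_ge0.
  - by apply/measurable_EFinP; exact: measurable_euler_kernel.
rewrite -e; apply/esym/(cvg_unique _ c2) => //.
have -> : (fun n => \int[mu]_(t in F n) (x * euler_kernel x t)%:E)%E =
    (fun n => \int[mu]_(t in F n) (euler_kernel (x + 1) t)%:E +
   (bdry x n.+2%:R - bdry x n.+1%:R^-1)%:E)%E by apply/funext/int_F_by_parts.
have -> : euler_int (x + 1) = (euler_int (x + 1) + 0)%E by rewrite adde0.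
apply: cvgeD => //; first exact: fin_num_adde_defl.
apply: cvg_EFin; first exact: nearW.
rewrite -[X in _ --> X](subr0 0); apply: cvgB.
  exact: bdry_cvg0y.
exact: bdry_cvg00.
Qed.

(** The integrand is the density of the exponential law of parameter 1. *)
Lemma euler_int1 : euler_int 1 = 1%E.
Proof.
rewrite -(@integral_exponential_pdf R 1 ltr01) /euler_int.
rewrite integral_itv_obnd_cbnd; last first.
  by apply/measurable_EFinP; exact: measurable_euler_kernel.
rewrite integral_mkcond; apply: eq_integral => t _.
rewrite /patch /exponential_pdf /patch; case: ifPn => // _.
by rewrite /euler_kernel subrr powRr0 !mul1r mulN1r.
Qed.

(** Pointwise t^(x - 1) <= t^(p - 1) + t^(q - 1): the second term suffices for
    t >= 1, the first one for t < 1. *)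
Lemma euler_int_le_add x p q : p <= x <= q ->
  (euler_int x <= euler_int p + euler_int q)%E.
Proof.
move=> /andP[px xq]; rewrite -ge0_integralD//=; last 4 first.
- by move=> t _; rewrite lee_fin euler_kernel_ge0.
- by apply/measurable_EFinP; exact: measurable_euler_kernel.
- by move=> t _; rewrite lee_fin euler_kernel_ge0.
- by apply/measurable_EFinP; exact: measurable_euler_kernel.
apply: ge0_le_integral => //=.
- by move=> t _; rewrite lee_fin euler_kernel_ge0.
- by apply/measurable_EFinP; exact: measurable_euler_kernel.
- apply/measurable_EFinP/measurable_funD; exact: measurable_euler_kernel.
move=> t; rewrite in_itv /= andbT => t0.
rewrite lee_fin -mulrDl ler_pM2r ?expR_gt0//.
have [t1|t1] := leP 1 t.
  by rewrite ler_wpDl ?powR_ge0//; apply: ler_powR => //; lra.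
rewrite ler_wpDr ?powR_ge0//; apply: ger_powR; last lra.
by rewrite t0 ltW.
Qed.

Lemma euler_int_ge0 x : (0 <= euler_int x)%E.
Proof. by apply: integral_ge0 => t _; rewrite lee_fin euler_kernel_ge0. Qed.

Lemma euler_gammaE (x : R) : euler_gamma x = fine (euler_int x).
Proof. by []. Qed.

(** By the functional equation it is enough to treat 0 < y <= 1.  There
    y G(y) = G(y + 1) <= G(1) + G(2) gives finiteness and
    1 = G(1) <= G(y) + G(y + 1) = (1 + y) G(y) gives positivity. *)
Lemma euler_int_fin_gt0 x : 0 < x ->
  (euler_int x \is a fin_num) && (0 < euler_int x)%E.
Proof.
have i2 : euler_int 2 = 1%E by rewrite -[2]/(1 + 1) euler_intS// euler_int1 mule1.
have step y : 0 < y -> (euler_int y \is a fin_num) && (0 < euler_int y)%E ->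
    (euler_int (y + 1) \is a fin_num) && (0 < euler_int (y + 1))%E.
  by move=> y0 /andP[f g]; rewrite euler_intS// fin_numM//= mule_gt0.
have small y : 0 < y <= 1 -> (euler_int y \is a fin_num) && (0 < euler_int y)%E.
  move=> /andP[y0 y1].
  have f1 : euler_int (y + 1) \is a fin_num.
    rewrite ge0_fin_numE ?euler_int_ge0//.
    apply: (@le_lt_trans _ _ (euler_int 1 + euler_int 2)%E).
      by apply: euler_int_le_add; lra.
    by rewrite euler_int1 i2 -EFinD ltry.
  move: f1 (euler_int_ge0 y) (@euler_int_le_add 1 y (y + 1)).
  rewrite euler_int1 euler_intS//.
  case: (euler_int y) => [r| |] //=; last by rewrite gt0_muley.
  rewrite !lee_fin lte_fin => _ r0 h; rewrite lt_neqAle r0 andbT.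
  apply/negP => /eqP r00; have := h _; rewrite -r00 mulr0 addr0.
  move=> {}h; have : (1 <= 0 :> R) by apply: h; lra.
  by rewrite ler10.
(* x is written as y + n with 0 < y <= 1, so an integer x has y = 1 *)
have key n y : 0 < y <= 1 ->
    (euler_int (y + n%:R) \is a fin_num) && (0 < euler_int (y + n%:R))%E.
  move=> y01; elim: n => [|n IH]; first by rewrite addr0; exact: small.
  rewrite -natr1 addrA; apply: step => //; case/andP: y01 => y0 _.
  by rewrite ltr_pwDl.
move=> x0; have [x1|x1] := leP x 1; first by apply: small; rewrite x0.
have /andP[l1 l2] := @truncn_itv R x (ltW x0).
have [e|ne] := eqVneq (Num.truncn x)%:R x.
  have m0 : (0 < Num.truncn x)%N by rewrite -(ltr0n R) e.
  have -> : x = 1 + (Num.truncn x).-1%:R by rewrite nat1r prednK.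
  by apply: key; rewrite ltr01 lexx.
have -> : x = (x - (Num.truncn x)%:R) + (Num.truncn x)%:R by rewrite subrK.
apply: key; rewrite -natr1 in l2; rewrite subr_gt0 lt_neqAle ne l1 /=.
by rewrite lerBlDr addrC ltW.
Qed.

Lemma euler_gammaS (x : R) : 0 < x -> euler_gamma (x + 1) = x * euler_gamma x.
Proof.
move=> x0; rewrite !euler_gammaE euler_intS//.
by rewrite fineM//; case/andP: (euler_int_fin_gt0 x0).
Qed.

Lemma euler_gamma_gt0 (x : R) : 0 < x -> 0 < euler_gamma x.
Proof.
move=> /euler_int_fin_gt0/andP[f g]; rewrite euler_gammaE fine_gt0// g.
by rewrite ltey_eq f.
Qed.

Lemma Gamma_gt0E (x : R) : 0 < x -> Gamma x = euler_gamma x.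
Proof.
move=> x0; rewrite /Gamma.
have -> : Num.truncn (1 - x) = 0%N.
  by apply/truncn0Pn; rewrite -ltNge; lra.
by rewrite big_ord0 addr0 divr1.
Qed.

(** Both sides satisfy c_(k+1) = (k + d - 1) / (k + 1) c_k.  Only Gamma (d - 1)
    has a negative argument, and one step of the extension to the left brings
    it back to Gamma d. *)
Lemma frac_coefE (d : R) k : 2^-1 < d -> d < 1 -> frac_coef d k = binom_coef (1 - d) k.
Proof.
move=> d1 d2; have d0 : 0 < d by apply: lt_trans d1; rewrite invr_gt0.
have Gd : Gamma (d - 1) = Gamma d / (d - 1).
  rewrite (Gamma_gt0E d0) /Gamma.
  have -> : Num.truncn (1 - (d - 1)) = 1%N by apply: truncn_def; lra.
  by rewrite big_ord_recr big_ord0 /= mul1r addr0 subrK.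
have gd : Gamma d != 0 by rewrite Gamma_gt0E// gt_eqF// euler_gamma_gt0.
have d10 : d - 1 != 0 by rewrite lt_eqF//; lra.
have G1 : Gamma 1 = 1 :> R by rewrite Gamma_gt0E// euler_gammaE euler_int1.
have GS (x : R) : 0 < x -> Gamma (x + 1) = x * Gamma x.
  by move=> x0; rewrite (Gamma_gt0E x0) Gamma_gt0E ?addr_gt0// euler_gammaS.
have Gn n : Gamma (n%:R + 1 : R) != 0.
  have n0 : 0 < n%:R + 1 :> R by rewrite ltr_wpDl.
  by rewrite Gamma_gt0E// gt_eqF// euler_gamma_gt0.
rewrite /frac_coef Gd; elim: k => [|k IH].
  by rewrite /binom_coef big_ord0 !add0r G1 mul1r Gd divff// mulf_neq0 ?invr_eq0.
rewrite /binom_coef big_ord_recr /= -/(binom_coef (1 - d) k) -IH.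
have -> : k.+1%:R + d - 1 = k%:R + d by rewrite -natr1; ring.
have k1 : k.+1%:R != 0 :> R by rewrite pnatr_eq0.
have -> : Gamma (k.+1%:R + 1 : R) = k.+1%:R * Gamma (k%:R + 1 : R).
  by rewrite GS ?ltr0n// -[in Gamma _]natr1.
have -> : Gamma (k%:R + d) = (k%:R + d - 1) * Gamma (k%:R + d - 1).
  case: k {IH k1} => [|k]; first by rewrite add0r Gd mulrC divfK.
  rewrite -GS; first by rewrite subrK.
  by rewrite -natr1 addrAC addrK ltr_wpDl.
have := Gn k; move: (Gamma (k%:R + 1)) (Gamma (k%:R + d - 1)) k1 => u v k1 u0.
by field; rewrite ?nat1r ?k1 ?u0 ?gd ?d10.
Qed.

End euler_integral.

(** * Expectation of products of independent variables *)

Section independence.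
Context (disp : measure_display) (T : measurableType disp) (R : realType).
Variable P : probability T R.

Import HBNNSimple.

(** The hypothesis says that the measure Z dP restricted to the sigma-algebra of
    V is c P.  It is the conclusion for indicators f, which extends by linearity
    to simple functions and by monotone convergence to nonnegative ones. *)
Lemma ge0_integral_indep (Z V : T -> R) (c : R) (f : R -> R) :
  measurable_fun setT Z -> (forall w, 0 <= Z w) -> measurable_fun setT V ->
  0 <= c ->
  (forall B, measurable B ->
     \int[P]_(w in V @^-1` B) (Z w)%:E = c%:E * P (V @^-1` B))%E ->
  measurable_fun setT f -> (forall x, 0 <= f x) ->
  (\int[P]_w (Z w * f (V w))%:E = c%:E * \int[P]_w (f (V w))%:E)%E.
Proof.
move=> mZ Z0 mV c0 ZV mf f0.
have mf' : measurable_fun setT (EFin \o f) by exact/measurable_EFinP.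
pose f_ := nnsfun_approx measurableT mf'.
have mc (g : R -> R) : measurable_fun setT g -> measurable_fun setT (g \o V).
  by move=> mg; exact: measurableT_comp.
have cf_ w : (f_ n (V w))%:E @[n --> \oo] --> (f (V w))%:E.
  by apply: (@cvg_nnsfun_approx _ _ _ _ _ _ mf') => // x _; rewrite lee_fin.
have ndf m n w : (m <= n)%N -> f_ m w <= f_ n w.
  by move=> mn; exact/lefP/nd_nnsfun_approx.
have mfn n : measurable_fun setT (f_ n \o V) by exact: mc.
have c1 : (\int[P]_w (Z w * f_ n (V w))%:E)%E @[n --> \oo] -->
    (\int[P]_w (Z w * f (V w))%:E)%E.
  rewrite [X in _ --> X](_ : _ =
      \int[P]_w limn (fun n => (Z w * f_ n (V w))%:E))%E; last first.
    apply: eq_integral => w _; apply/esym/cvg_lim => //.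
    under eq_fun do rewrite EFinM.
    by rewrite EFinM; apply: cvgeZl => //; exact: cf_.
  apply: cvg_monotone_convergence => //.
  - move=> n; apply/measurable_EFinP; apply: measurable_funM => //; exact: mfn.
  - by move=> n w _; rewrite lee_fin mulr_ge0.
  - by move=> w _ m n mn; rewrite lee_fin ler_wpM2l// ndf.
have c2 : (c%:E * \int[P]_w (f_ n (V w))%:E)%E @[n --> \oo] -->
    (c%:E * \int[P]_w (f (V w))%:E)%E.
  apply: cvgeZl => //; rewrite [X in _ --> X](_ : _ =
      \int[P]_w limn (fun n => (f_ n (V w))%:E))%E; last first.
    by apply: eq_integral => w _; apply/esym/cvg_lim => //; exact: cf_.
  apply: cvg_monotone_convergence => //.
  - by move=> n; apply/measurable_EFinP; exact: mfn.
  - by move=> n w _; rewrite lee_fin.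
  - by move=> w _ m n mn; rewrite lee_fin ndf.
apply/esym/(cvg_unique _ c2) => //.
suff -> : (fun n => c%:E * \int[P]_w (f_ n (V w))%:E)%E =
   (fun n => \int[P]_w (Z w * f_ n (V w))%:E)%E by [].
apply/funext => n; move: (f_ n) => g {c1 c2}.
have mA r : measurable (V @^-1` (g @^-1` [set r])).
  by rewrite -[X in measurable X]setTI; apply: mV.
have gE w : g (V w) = \sum_(r \in range g) (r * \1_(V @^-1` (g @^-1` [set r])) w).
  by rewrite fimfunE.
have fin : finite_set (range g) by exact: fimfunP.
have pos r w : 0 <= r * \1_(V @^-1` (g @^-1` [set r])) w.
  rewrite indicE; case: (boolP (w \in _)) => [|_]; last by rewrite mulr0.
  by rewrite inE /= mulr1 => <-.
have mr r : measurable_fun setT (fun w => r * \1_(V @^-1` (g @^-1` [set r])) w).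
  by apply: measurable_funM => //; exact: measurable_indic.
have i1 : (\int[P]_w (g (V w))%:E =
   \sum_(r \in range g) r%:E * P (V @^-1` (g @^-1` [set r])))%E.
  under eq_integral do rewrite gE -fsumEFin//.
  rewrite ge0_integral_fsum//; last 2 first.
  - by move=> r; apply/measurable_EFinP.
  - by move=> r w _; rewrite lee_fin.
  apply: eq_fsbigr => r; rewrite inE => -[x _ rx].
  under eq_integral do rewrite EFinM.
  rewrite ge0_integralZl_EFin -?rx//; last first.
    by apply/measurable_EFinP; exact: measurable_indic.
  by rewrite integral_indic// setIT.
have i2 : (\int[P]_w (Z w * g (V w))%:E =
   \sum_(r \in range g) r%:E * (c%:E * P (V @^-1` (g @^-1` [set r]))))%E.
  have ZgE w : (Z w * g (V w))%:E =
      (\sum_(r \in range g) (r * (Z w * \1_(V @^-1` (g @^-1` [set r])) w))%:E)%E.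
    rewrite fsumEFin//; congr EFin; rewrite gE !fsbig_finite//= mulr_sumr.
    by apply: eq_bigr => r _; rewrite mulrCA.
  under eq_integral do rewrite ZgE.
  rewrite ge0_integral_fsum//; last 2 first.
  - move=> r; apply/measurable_EFinP; apply: measurable_funM => //.
    by apply: measurable_funM => //; exact: measurable_indic.
  - by move=> r w _; rewrite lee_fin mulrCA mulr_ge0.
  apply: eq_fsbigr => r; rewrite inE => -[x _ rx].
  under eq_integral do rewrite EFinM.
  rewrite ge0_integralZl_EFin -?rx//; last 2 first.
  - by move=> w _; rewrite lee_fin mulr_ge0.
  - by apply/measurable_EFinP; apply: measurable_funM.
  congr (_ * _)%E; rewrite -ZV; last by rewrite -[X in measurable X]setTI; exact: measurable_funP.
  rewrite [RHS]integral_mkcond; apply: eq_integral => w _.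
  rewrite /patch indicE; case: ifP => _; first by rewrite mulr1.
  by rewrite mulr0.
rewrite i1 i2 ge0_mule_fsumr; last first.
  move=> r; have [r0|r0] := leP 0 r; first by rewrite mule_ge0.
  rewrite (_ : _ @^-1` _ = set0) ?measure0 ?mule0//.
  rewrite -subset0 => w /= gr; have : 0 <= g (V w) by [].
  by rewrite gr leNgt r0.
by apply: eq_fsbigr => r _; rewrite muleCA.
Qed.

Lemma integrable_ge0 (f : T -> R) : measurable_fun setT f ->
  (forall w, 0 <= f w) -> (\int[P]_w (f w)%:E < +oo)%E ->
  P.-integrable setT (EFin \o f).
Proof.
move=> mf f0 h; apply/integrableP; split; first exact/measurable_EFinP.
by under eq_integral do rewrite gee0_abs ?lee_fin//.
Qed.

Variables (I : choiceType) (X : I -> {RV P >-> R}).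
Hypothesis X_indep : mutually_independent P X.

(** Independence is given on events, so the factors are turned into integrands
    one at a time: an event on the remaining indices J is carried along, and in
    the induction step it absorbs the test event {X_i in C} which
    [ge0_integral_indep] asks about. *)
Lemma ge0_indep_prod (s : seq (I * (R -> R))) (J : {fset I})
    (B : I -> set R) :
  uniq (map fst s) -> (forall x, x \in s -> x.1 \notin J) ->
  (forall i, measurable (B i)) ->
  (forall x, x \in s -> [/\ measurable_fun setT x.2, forall t, 0 <= x.2 t &
     P.-integrable setT (fun w => (x.2 (X x.1 w))%:E)]) ->
  (\int[P]_(w in \bigcap_(i in [set` J]) (X i @^-1` B i))
      (\prod_(x <- s) x.2 (X x.1 w))%:E =
   P (\bigcap_(i in [set` J]) (X i @^-1` B i)) *
     \prod_(x <- s) \int[P]_w (x.2 (X x.1 w))%:E)%E.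
Proof.
elim: s J B => [|[i g] s IH] J B.
  move=> _ _ mB _; rewrite big_nil mule1.
  under eq_integral do rewrite big_nil.
  rewrite integral_cst ?mul1e//; apply: fin_bigcap_measurable => [|k _]; first exact: finite_fset.
  by rewrite -[X in measurable X]setTI; exact: measurable_funP.
rewrite map_cons cons_uniq => /andP[is1 us] sJ mB int_s.
have iJ : i \notin J by have := sJ (i, g) (mem_head _ _).
have [mg g0 ig] := int_s (i, g) (mem_head _ _).
have int_s' x : x \in s -> [/\ measurable_fun setT x.2, forall t, 0 <= x.2 t &
     P.-integrable setT (fun w => (x.2 (X x.1 w))%:E)].
  by move=> xs; apply: int_s; rewrite inE xs orbT.
set E := \bigcap_(_ in _) _.
have mXB k C : measurable C -> measurable (X k @^-1` C).
  by move=> mC; rewrite -[X in measurable X]setTI; exact: measurable_funP.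
have mE : measurable E.
  by apply: fin_bigcap_measurable => [|k _]; [exact: finite_fset|exact: mXB].
pose q : \bar R := (\prod_(x <- s) \int[P]_w (x.2 (X x.1 w))%:E)%E.
have q_fin : q \is a fin_num /\ (0 <= q)%E.
  rewrite /q; split; rewrite big_seq; elim/big_ind : _ => //.
  - by move=> x y; exact: fin_numM.
  - by move=> x /int_s'[mx x0 ix]; exact: integrable_fin_num.
  - by move=> x y; exact: mule_ge0.
  - by move=> x /int_s'[mx x0 ix]; apply: integral_ge0 => w _; rewrite lee_fin.
have mprod : measurable_fun setT (fun w => \prod_(x <- s) x.2 (X x.1 w)).
  apply: measurable_prod => x /int_s'[mx x0 ix].
  exact: measurableT_comp.
have prod0 w : 0 <= \prod_(x <- s) x.2 (X x.1 w).
  by rewrite big_seq; apply: prodr_ge0 => x /int_s'[].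
have PEq : (P E * q)%E \is a fin_num by rewrite fin_numM ?fin_num_measure//; case: q_fin.
pose c := fine (P E * q)%E.
have main := @ge0_integral_indep (fun w => \1_E w * \prod_(x <- s) x.2 (X x.1 w))
  (X i) c g _ _ _ _ _ mg g0.
rewrite big_cons -/q /=.
have -> : (\int[P]_(w in E) (\prod_(x <- (i, g) :: s) x.2 (X x.1 w))%:E =
    \int[P]_w (\1_E w * \prod_(x <- s) x.2 (X x.1 w) * g (X i w))%:E)%E.
  rewrite integral_mkcond; apply: eq_integral => w _.
  rewrite /patch indicE big_cons /=; case: ifP => _.
    by rewrite mul1r mulrC.
  by rewrite !mul0r.
rewrite main //.
- by rewrite /c fineK// muleA muleAC.
- by apply: measurable_funM => //; exact: measurable_indic.
- by move=> w; rewrite mulr_ge0.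
- by rewrite /c fine_ge0// mule_ge0//; case: q_fin.
move=> C mC.
pose B' k := if k == i then C else B k.
have mB' k : measurable (B' k) by rewrite /B'; case: ifP.
have E'E : \bigcap_(k in [set` (i |` J)%fset]) (X k @^-1` B' k) = E `&` (X i @^-1` C).
  apply/seteqP; split => w.
    move=> h; split; last by have := h i; rewrite /= /B' eqxx; apply; rewrite !inE eqxx.
    move=> k /= kJ; have := h k; rewrite /= /B'; case: eqP => [ki|_]; last first.
      by apply; rewrite !inE kJ orbT.
    by move: iJ; rewrite -ki kJ.
  move=> [wE wC] k /=; rewrite /B' !inE; case: eqP => [-> //|_ /= kJ].
  exact: wE.
have := IH (i |` J)%fset B' us _ mB' int_s'; rewrite E'E => IH'.
have -> : (\int[P]_(w in X i @^-1` C) (\1_E w * \prod_(x <- s) x.2 (X x.1 w))%:E =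
  \int[P]_(w in E `&` X i @^-1` C) (\prod_(x <- s) x.2 (X x.1 w))%:E)%E.
  rewrite integral_mkcond [RHS]integral_mkcond; apply: eq_integral => w _.
  rewrite /patch indicE in_setI; case: (w \in E) => /=; last by case: ifP; rewrite ?mul0r.
  by rewrite mul1r.
rewrite IH'; last first.
  move=> x xs; rewrite !inE negb_or sJ ?inE ?xs ?orbT// andbT.
  by apply: contraNN is1 => /eqP <-; exact: (map_f fst xs).
rewrite /c fineK// -/q -E'E X_indep// big_fsetU1//= {1}/B' eqxx.
rewrite [X in (P _ * X * q)%E](_ : _ = P E).
  by rewrite [RHS]muleC muleA.
rewrite /E X_indep//; apply: eq_big_seq => k kJ; rewrite /B'.
by case: eqP => // ki; move: iJ; rewrite -ki kJ.
Qed.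

(** The positive and negative parts of each factor are split off in turn; t
    collects the factors already made nonnegative. *)
Lemma indep_prod (s : seq (I * (R -> R))) :
  uniq (map fst s) ->
  (forall x, x \in s -> measurable_fun setT x.2 /\
     P.-integrable setT (fun w => (x.2 (X x.1 w))%:E)) ->
  P.-integrable setT (fun w => (\prod_(x <- s) x.2 (X x.1 w))%:E) /\
  \int[P]_w (\prod_(x <- s) x.2 (X x.1 w)) =
    \prod_(x <- s) \int[P]_w (x.2 (X x.1 w)).
Proof.
move=> us int_s.
suff gen (t : seq (I * (R -> R))) : uniq (map fst (s ++ t)) ->
   (forall x, x \in t -> [/\ measurable_fun setT x.2, forall t, 0 <= x.2 t &
     P.-integrable setT (fun w => (x.2 (X x.1 w))%:E)]) ->
   P.-integrable setT (fun w => (\prod_(x <- s ++ t) x.2 (X x.1 w))%:E) /\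
  \int[P]_w (\prod_(x <- s ++ t) x.2 (X x.1 w)) =
    \prod_(x <- s ++ t) \int[P]_w (x.2 (X x.1 w)).
  by have := gen [::]; rewrite cats0; apply.
elim: s {us} int_s t => [_ t ut int_t|[i g] s IH int_s t].
  rewrite cat0s in ut *.
  have := @ge0_indep_prod t fset0 (fun=> setT) ut _ _ int_t.
  rewrite [X in P X](_ : _ = setT); last first.
    by apply/seteqP; split => // w _ k.
  rewrite [X in integral _ X](_ : _ = setT); last first.
    by apply/seteqP; split => // w _ k.
  rewrite probability_setT mul1e => /(_ _ _)-h.
  have {}h : (\int[P]_w (\prod_(x <- t) x.2 (X x.1 w))%:E =
     (\prod_(x <- t) \int[P]_w x.2 (X x.1 w))%:E)%E.
    rewrite h // -prodEFin; apply: eq_big_seq => x /int_t[_ _ ix].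
    by rewrite /Rintegral fineK//; exact: integrable_fin_num.
  split; last by rewrite /Rintegral h.
  apply: integrable_ge0; last by rewrite h ltry.
    apply: measurable_prod => x /int_t[mx _ _]; exact: measurableT_comp.
  by move=> w; rewrite big_seq; apply: prodr_ge0 => x /int_t[].
move=> us int_t; have [mg ig] := int_s (i, g) (mem_head _ _).
rewrite /= in mg ig.
have int_s' x : x \in s -> measurable_fun setT x.2 /\
     P.-integrable setT (fun w => (x.2 (X x.1 w))%:E).
  by move=> xs; apply: int_s; rewrite inE xs orbT.
have step (h : R -> R) : measurable_fun setT h -> (forall x, 0 <= h x) ->
   P.-integrable setT (fun w => (h (X i w))%:E) ->
   P.-integrable setT (fun w => (h (X i w) * \prod_(x <- s ++ t) x.2 (X x.1 w))%:E) /\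
  \int[P]_w (h (X i w) * \prod_(x <- s ++ t) x.2 (X x.1 w)) =
    (\int[P]_w (h (X i w))) * \prod_(x <- s ++ t) \int[P]_w (x.2 (X x.1 w)).
  move=> mh h0 ih.
  have pull (F : (I * (R -> R)) -> R) : \prod_(x <- s ++ (i, h) :: t) F x =
      F (i, h) * \prod_(x <- s ++ t) F x.
    by rewrite !big_cat big_cons /= mulrCA.
  have [] := IH int_s' ((i, h) :: t) _ _.
  - by rewrite map_cat map_cons -[_ :: _]cat1s uniq_catCA cat1s -map_cat.
  - by move=> x; rewrite inE => /orP[/eqP -> //|/int_t].
  rewrite pull => i1 i2; split.
    by move: i1; apply: eq_integrable => // w _; rewrite pull.
  by rewrite -i2; apply: eq_Rintegral => w _; rewrite pull.
have pE (f : R -> R) x : f x = f^\+ x - f^\- x by rewrite -[in LHS](funrposBneg f).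
have [ip ep] := step g^\+ (measurable_funrpos mg) (funrpos_ge0 g)
   (integrable_funrpos measurableT ig).
have [im em] := step g^\- (measurable_funrneg mg) (funrneg_ge0 g)
   (integrable_funrneg measurableT ig).
have e w : \prod_(x <- ((i, g) :: s) ++ t) x.2 (X x.1 w) =
   g^\+ (X i w) * \prod_(x <- s ++ t) x.2 (X x.1 w) -
   g^\- (X i w) * \prod_(x <- s ++ t) x.2 (X x.1 w).
  by rewrite cat_cons big_cons /= -mulrBl -pE.
split.
  have := integrableB measurableT ip im; apply: eq_integrable => // w _.
  by rewrite /= -EFinB -e.
rewrite (eq_Rintegral _ (fun w _ => e w)) RintegralB// ep em -mulrBl.
rewrite cat_cons big_cons /= -RintegralB//.
- by congr (_ * _); apply: eq_Rintegral => w _; rewrite -pE.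
- exact: (integrable_funrpos measurableT ig).
- exact: (integrable_funrneg measurableT ig).
Qed.

End independence.

(** * Moments of the innovations *)

Section moments.
Context (disp : measure_display) (T : measurableType disp) (R : realType).
Variable P : probability T R.
Variable eps : int -> {RV P >-> R}.
Hypothesis eps_indep : mutually_independent P eps.
Hypothesis eps_id : identically_distributed P eps.
Hypothesis eps_mean : forall i, ('E_P[eps i] = 0)%E.
Hypothesis eps_var : forall i, ('V_P[eps i] = 1)%E.
Hypothesis eps_4 : ('E_P[fun w => (eps 1 w ^+ 4)%R] < +oo)%E.

Definition moment k : R := \int[P]_w (eps 1 w ^+ k).

Lemma ge0_integral_eps (f : R -> R) i j : measurable_fun setT f ->
  (forall x, 0 <= f x) ->
  (\int[P]_w (f (eps i w))%:E = \int[P]_w (f (eps j w))%:E)%E.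
Proof.
move=> mf f0.
rewrite -(@ge0_integral_distribution _ _ _ _ _ P (eps i) (EFin \o f)); last 2 first.
- exact/measurable_EFinP.
- by move=> x; rewrite lee_fin.
rewrite -(@ge0_integral_distribution _ _ _ _ _ P (eps j) (EFin \o f)); last 2 first.
- exact/measurable_EFinP.
- by move=> x; rewrite lee_fin.
by apply: eq_measure_integral => A mA _; exact: eps_id.
Qed.

(** |x|^k <= 1 + x^4 for k <= 4. *)
Lemma integrable_eps_pow i k : (k <= 4)%N ->
  P.-integrable setT (fun w => (eps i w ^+ k)%:E).
Proof.
move=> k4.
have me n : measurable_fun setT (fun w => eps i w ^+ n) by exact: measurable_funX.
have i4 : P.-integrable setT (fun w => (eps i w ^+ 4)%:E).
  apply: (@integrable_ge0 _ _ _ P (fun w => eps i w ^+ 4)) => //.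
    by move=> w; rewrite exprn_even_ge0.
  rewrite (@ge0_integral_eps (fun x => x ^+ 4) i 1) => [||x].
  - by move: eps_4; rewrite unlock.
  - exact: exprn_measurable.
  - by rewrite exprn_even_ge0.
have i1 : P.-integrable setT (EFin \o cst (1 : R)).
  exact: finite_measure_integrable_cst.
have := integrableD measurableT i1 i4; apply: le_integrable => //.
  exact/measurable_EFinP.
move=> w _; rewrite -[leRHS]/(`|(1 + eps i w ^+ 4)%:E|)%E !abse_EFin lee_fin.
rewrite [leRHS]ger0_norm ?addr_ge0 ?exprn_even_ge0// normrX.
have -> : eps i w ^+ 4 = `|eps i w| ^+ 4.
  by rewrite -normrX ger0_norm// exprn_even_ge0.
have [h|h] := leP `|eps i w| 1.
  by rewrite ler_wpDr ?exprn_ge0// exprn_ile1.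
by rewrite ler_wpDl// ler_weXn2l// ltW.
Qed.

Lemma moment_eps i k : (k <= 4)%N -> \int[P]_w (eps i w ^+ k) = moment k.
Proof.
move=> k4; rewrite /moment /Rintegral; congr fine.
have mX : measurable_fun setT (fun x : R => (x ^+ k)%:E).
  by apply/measurable_EFinP; exact: exprn_measurable.
rewrite -(@integral_distribution _ _ _ _ _ P (eps i) (fun x : R => (x ^+ k)%:E)) //;
  last exact: integrable_eps_pow.
rewrite -(@integral_distribution _ _ _ _ _ P (eps 1) (fun x : R => (x ^+ k)%:E)) //;
  last exact: integrable_eps_pow.
by apply: eq_measure_integral => A mA _; exact: eps_id.
Qed.

Lemma moment1 : moment 1 = 0.
Proof.
have := eps_mean 1; rewrite unlock /moment /Rintegral => e.
by rewrite (eq_integral (fun w => (eps 1 w)%:E)) ?e.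
Qed.

Lemma moment2 : moment 2 = 1.
Proof.
have := eps_var 1; rewrite /variance unlock eps_mean /= unlock.
rewrite /moment /Rintegral => e.
rewrite (eq_integral (fun w => (((eps 1 \- cst 0) * (eps 1 \- cst 0)) w)%:E)) ?e//.
by move=> w _; rewrite /= fctE /= subr0 expr2.
Qed.

(** Equal indices are grouped first, since only distinct ones are independent. *)
Lemma expectation_prod_eps (s : seq int) : (size s <= 4)%N ->
  P.-integrable setT (fun w => (\prod_(i <- s) eps i w)%:E) /\
  \int[P]_w (\prod_(i <- s) eps i w) = \prod_(i <- undup s) moment (count_mem i s).
Proof.
move=> s4.
have cs i : (count_mem i s <= 4)%N by apply: leq_trans s4; exact: count_size.
pose fs : seq (int * (R -> R)) :=
  [seq (i, (fun x : R => x ^+ count_mem i s)) | i <- undup s].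
have e w : \prod_(i <- s) eps i w = \prod_(x <- fs) x.2 (eps x.1 w).
  rewrite -big_undup_iterop_count big_map.
  by apply: eq_bigr => i _.
have [] := @indep_prod _ _ _ P _ eps eps_indep fs.
- by rewrite -map_comp map_id undup_uniq.
- move=> x /mapP[i _ -> /=]; split; first exact: exprn_measurable.
  exact: integrable_eps_pow.
move=> i1 i2; split.
  by move: i1; apply: eq_integrable => // w _; rewrite e.
rewrite (eq_Rintegral _ (fun w _ => e w)) i2 big_map.
by apply: eq_bigr => i _; rewrite moment_eps.
Qed.

Lemma integrable_eps2 i j : P.-integrable setT (fun w => (eps i w * eps j w)%:E).
Proof.
have [+ _] := @expectation_prod_eps [:: i; j] isT; apply: eq_integrable => // w _.
by rewrite !big_cons big_nil mulr1.
Qed.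

Lemma integrable_eps4 i j k l :
  P.-integrable setT (fun w => (eps i w * eps j w * eps k w * eps l w)%:E).
Proof.
have [+ _] := @expectation_prod_eps [:: i; j; k; l] isT; apply: eq_integrable => // w _.
by rewrite !big_cons big_nil mulr1 !mulrA.
Qed.

Lemma moment_eps2 i j : \int[P]_w (eps i w * eps j w) = (i == j)%:R.
Proof.
have [_ h] := @expectation_prod_eps [:: i; j] isT.
have e w : eps i w * eps j w = \prod_(i <- [:: i; j]) eps i w.
  by rewrite !big_cons big_nil mulr1.
rewrite (eq_Rintegral _ (fun w _ => e w)).
rewrite h /=; case: eqVneq => [->|ij].
  by rewrite inE eqxx big_cons big_nil /= eqxx mulr1 moment2.
have ji : j == i = false by rewrite eq_sym (negbTE ij).
by rewrite inE (negbTE ij) !big_cons big_nil /= !eqxx (negbTE ij) ji moment1 mul0r.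
Qed.

(** The fourth cumulant of the innovations. *)
Definition excess : R := moment 4 - 3.

Local Ltac eqs := repeat (progress (rewrite ?eqxx /=;
  repeat match goal with H : prod _ _ |- _ => progress rewrite ?H /= end)).

(** The three pairings are the Gaussian value; when all indices agree they
    count 3 instead of the true fourth moment, whence the last term. *)
Lemma moment_eps4 i j k l :
  \int[P]_w (eps i w * eps j w * eps k w * eps l w) =
  (i == j)%:R * (k == l)%:R + (i == k)%:R * (j == l)%:R +
  (i == l)%:R * (j == k)%:R +
  excess * ((i == j)%:R * (i == k)%:R * (i == l)%:R).
Proof.
have [_ h] := @expectation_prod_eps [:: i; j; k; l] isT.
have e w : eps i w * eps j w * eps k w * eps l w =
    \prod_(i <- [:: i; j; k; l]) eps i w.
  by rewrite !big_cons big_nil mulr1 !mulrA.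
rewrite (eq_Rintegral _ (fun w _ => e w)).
rewrite h /= !inE {h}.
(* the moment depends only on which indices coincide, so that one closed
   computation is left for each set partition of the four positions *)
have sym (a b : int) : a != b -> (a == b = false) * (b == a = false).
  by move=> ab; split; [|rewrite eq_sym]; exact: negbTE.
have [e1|/sym e1] := eqVneq i j; first subst j;
have [e2|/sym e2] := eqVneq i k; try subst k;
have [e3|/sym e3] := eqVneq i l; try subst l; eqs;
try (have [e4|/sym e4] := eqVneq k l; [try subst l|]; eqs);
try (have [e5|/sym e5] := eqVneq j k; [try subst k|]; eqs);
try (have [e6|/sym e6] := eqVneq j l; [try subst l|]; eqs);
rewrite ?big_cons ?big_nil; eqs; rewrite ?(moment1, moment2) /excess ?(addn0,addnA) /=;
ring.
Qed.

End moments.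

(** * Finite linear forms in the innovations *)

(** A form is a sequence of pairs (weight, index) in which an index may be
    repeated, so that the sum of two forms is their concatenation and no
    normalisation is ever needed. *)
Section linear_forms.
Variable R : realType.
Implicit Types s t : seq (R * int).

Definition coef s (m : int) : R := \sum_(x <- s | x.2 == m) x.1.
Definition l1norm s : R := \sum_(x <- s) `|x.1|.
(** The inner product of the coefficient families, written asymmetrically so as
    to be additive in the first form by construction. *)
Definition cdot s t : R := \sum_(x <- s) x.1 * coef t x.2.
(** \sum_m of the product of the four coefficients at m, which carries the
    fourth cumulant. *)
Definition cdot4 s1 s2 s3 s4 : R :=
  \sum_(x <- s1) x.1 * (coef s2 x.2 * coef s3 x.2 * coef s4 x.2).

Lemma sum_coef s m : \sum_(x <- s) x.1 * (m == x.2)%:R = coef s m.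
Proof.
rewrite /coef [RHS]big_mkcond; apply: eq_bigr => x _.
by rewrite eq_sym; case: eqP; rewrite ?mulr1 ?mulr0.
Qed.

Lemma sum_coef_fun s (r : seq int) (F : int -> R) :
  uniq r -> {subset map snd s <= r} ->
  \sum_(x <- s) x.1 * F x.2 = \sum_(m <- r) coef s m * F m.
Proof.
move=> ur sr.
under [RHS]eq_bigr do rewrite /coef mulr_suml big_mkcond.
rewrite exchange_big /= big_seq [RHS]big_seq; apply: eq_bigr => x xs.
rewrite (bigD1_seq x.2) ?eqxx ?sr ?map_f//= big1 ?addr0// => m mx.
by rewrite eq_sym (negbTE mx).
Qed.

Lemma cdotC s t : cdot s t = cdot t s.
Proof.
pose r := undup (map snd s ++ map snd t).
have ur : uniq r by exact: undup_uniq.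
have sr : {subset map snd s <= r} by move=> m h; rewrite mem_undup mem_cat h.
have tr : {subset map snd t <= r} by move=> m h; rewrite mem_undup mem_cat h orbT.
rewrite /cdot (sum_coef_fun _ ur sr) (sum_coef_fun _ ur tr).
by apply: eq_bigr => m _; rewrite mulrC.
Qed.

(** Bessel's inequality: the squared norm dominates the part of it carried by
    any set of distinct indices. *)
Lemma cdot_ge s (r : seq int) : uniq r ->
  \sum_(m <- r) coef s m ^+ 2 <= cdot s s.
Proof.
move=> ur; pose r' := r ++ [seq m <- undup (map snd s) | m \notin r].
have ur' : uniq r'.
  rewrite cat_uniq ur filter_uniq ?undup_uniq// andbT /=.
  by apply/hasPn => m; rewrite mem_filter => /andP[].
have sr' : {subset map snd s <= r'}.
  move=> m ms; rewrite mem_cat mem_filter mem_undup ms andbT.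
  by case: (m \in r).
rewrite /cdot (sum_coef_fun _ ur' sr') big_cat /= ler_wpDr//.
by apply: sumr_ge0 => m _; rewrite -expr2 sqr_ge0.
Qed.

Lemma coef_cat s t m : coef (s ++ t) m = coef s m + coef t m.
Proof. by rewrite /coef big_cat. Qed.

Lemma coef_flatten (ss : seq (seq (R * int))) m :
  coef (flatten ss) m = \sum_(s <- ss) coef s m.
Proof. by rewrite /coef big_flatten. Qed.

Lemma norm_coef_le s m : `|coef s m| <= l1norm s.
Proof.
rewrite /coef /l1norm (le_trans (ler_norm_sum _ _ _))// big_mkcond.
by apply: ler_sum => x _; case: ifP.
Qed.

Lemma norm_cdot_le s t (M : R) : (forall m, `|coef t m| <= M) ->
  `|cdot s t| <= l1norm s * M.
Proof.
move=> tM; rewrite /cdot (le_trans (ler_norm_sum _ _ _))// mulr_suml.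
by apply: ler_sum => x _; rewrite normrM ler_wpM2l.
Qed.

Lemma norm_cdot4_le s1 s2 s3 s4 (M2 M3 M4 : R) :
  (forall m, `|coef s2 m| <= M2) -> (forall m, `|coef s3 m| <= M3) ->
  (forall m, `|coef s4 m| <= M4) ->
  `|cdot4 s1 s2 s3 s4| <= l1norm s1 * (M2 * M3 * M4).
Proof.
move=> b2 b3 b4; rewrite /cdot4 (le_trans (ler_norm_sum _ _ _))// mulr_suml.
apply: ler_sum => x _; rewrite normrM ler_wpM2l// !normrM.
by rewrite !ler_pM ?mulr_ge0.
Qed.

End linear_forms.

Section linear_form_moments.
Context (disp : measure_display) (T : measurableType disp) (R : realType).
Variable P : probability T R.
Variable eps : int -> {RV P >-> R}.
Hypothesis eps_indep : mutually_independent P eps.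
Hypothesis eps_id : identically_distributed P eps.
Hypothesis eps_mean : forall i, ('E_P[eps i] = 0)%E.
Hypothesis eps_var : forall i, ('V_P[eps i] = 1)%E.
Hypothesis eps_4 : ('E_P[fun w => (eps 1 w ^+ 4)%R] < +oo)%E.
Implicit Types s t : seq (R * int).

Definition lin s (w : T) : R := \sum_(x <- s) x.1 * eps x.2 w.

Lemma measurable_lin s : measurable_fun setT (lin s).
Proof. by apply: measurable_sum => x; apply: measurable_funM. Qed.

Lemma lin_cat s t w : lin (s ++ t) w = lin s w + lin t w.
Proof. by rewrite /lin big_cat. Qed.

(** Expanding a single factor: repeated use computes moments of products of
    forms without multiple sums. *)
Lemma lin_mulE (G : T -> R) (v : int -> R) s :
  (forall i, P.-integrable setT (fun w => (eps i w * G w)%:E) /\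
     \int[P]_w (eps i w * G w) = v i) ->
  P.-integrable setT (fun w => (lin s w * G w)%:E) /\
  \int[P]_w (lin s w * G w) = \sum_(x <- s) x.1 * v x.2.
Proof.
move=> iG; elim: s => [|x s [i1 i2]].
  split; first by under eq_fun do rewrite /lin big_nil mul0r; exact: integrable0.
  rewrite /lin big_nil; under eq_Rintegral do rewrite big_nil mul0r.
  by rewrite /Rintegral integral0.
have e w : lin (x :: s) w * G w = x.1 * (eps x.2 w * G w) + lin s w * G w.
  by rewrite /lin big_cons mulrDl -mulrA.
have [j1 j2] := iG x.2.
have j3 : P.-integrable setT (fun w => (x.1 * (eps x.2 w * G w))%:E).
  by have := integrableZl measurableT x.1 j1; apply: eq_integrable.
split.
  have := integrableD measurableT j3 i1; apply: eq_integrable => // w _.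
  by rewrite e.
rewrite (eq_Rintegral _ (fun w _ => e w)) RintegralD// i2 big_cons.
by rewrite RintegralZl// j2.
Qed.

Lemma lin_mean s : \int[P]_w lin s w = 0.
Proof.
have [i|_ h] := @lin_mulE (cst 1) (fun=> 0) s.
  split.
    have [+ _] := expectation_prod_eps eps_indep eps_id eps_4 (s := [:: i]) isT.
    by apply: eq_integrable => // w _; rewrite big_cons big_nil.
  under eq_Rintegral do rewrite mulr1.
  by have := eps_mean i; rewrite unlock /Rintegral => ->.
transitivity (\int[P]_w (lin s w * cst 1 w)).
  by apply: eq_Rintegral => w _; rewrite mulr1.
by rewrite h big1// => x _; rewrite mulr0.
Qed.

Lemma lin_moment2 s t :
  P.-integrable setT (fun w => (lin s w * lin t w)%:E) /\
  \int[P]_w (lin s w * lin t w) = cdot s t.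
Proof.
apply: (lin_mulE (v := coef t)) => i.
have [j|h1 h2] := @lin_mulE (eps i) (fun j => (i == j)%:R) t.
  split; first exact: integrable_eps2.
  by rewrite moment_eps2// eq_sym.
split; first by move: h1; apply: eq_integrable => // w _; rewrite mulrC.
by under eq_Rintegral do rewrite mulrC; rewrite h2 sum_coef.
Qed.

(** The four factors are expanded one after the other, from the last to the
    first. *)
Lemma lin_moment4 s1 s2 s3 s4 :
  P.-integrable setT (fun w => (lin s1 w * lin s2 w * lin s3 w * lin s4 w)%:E) /\
  \int[P]_w (lin s1 w * lin s2 w * lin s3 w * lin s4 w) =
  cdot s1 s2 * cdot s3 s4 + cdot s1 s3 * cdot s2 s4 + cdot s1 s4 * cdot s2 s3 +
  excess eps * cdot4 s1 s2 s3 s4.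
Proof.
pose d (i j : int) : R := (i == j)%:R.
set q := excess eps.
have dE s i (c : R) : \sum_(x <- s) x.1 * (c * d i x.2) = c * coef s i.
  rewrite -sum_coef mulr_sumr; apply: eq_bigr => x _; exact: mulrCA.
have cE s (f : int -> R) (c : R) : \sum_(x <- s) x.1 * (c * f x.2) =
    c * \sum_(x <- s) x.1 * f x.2.
  by rewrite mulr_sumr; apply: eq_bigr => x _; exact: mulrCA.
have h4 i j k : P.-integrable setT (fun w => (lin s4 w * (eps i w * eps j w * eps k w))%:E) /\
  \int[P]_w (lin s4 w * (eps i w * eps j w * eps k w)) =
   d i j * coef s4 k + d i k * coef s4 j + d j k * coef s4 i +
    q * d i j * d i k * coef s4 i.
  have [l|h1 h2] := @lin_mulE (fun w => eps i w * eps j w * eps k w)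
    (fun l => d i j * d k l + d i k * d j l + d j k * d i l + q * d i j * d i k * d i l) s4.
    have e w : eps l w * (eps i w * eps j w * eps k w) =
      eps i w * eps j w * eps k w * eps l w by rewrite mulrC.
    split.
      have := integrable_eps4 eps_indep eps_id eps_4 i j k l.
      by apply: eq_integrable => // w _; rewrite e.
    rewrite (eq_Rintegral _ (fun w _ => e w)) moment_eps4// /d /q; ring.
  split=> //; rewrite h2.
  by under eq_bigr do rewrite !mulrDr; rewrite !big_split /= !dE.
have h3 i j : P.-integrable setT (fun w => (lin s3 w * (eps i w * eps j w * lin s4 w))%:E) /\
  \int[P]_w (lin s3 w * (eps i w * eps j w * lin s4 w)) =
   d i j * cdot s3 s4 + coef s3 i * coef s4 j + coef s3 j * coef s4 i +
    q * d i j * coef s3 i * coef s4 i.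
  have [k|h1 h2] := @lin_mulE (fun w => eps i w * eps j w * lin s4 w)
    (fun k => d i j * coef s4 k + coef s4 j * d i k + coef s4 i * d j k +
       (q * d i j * coef s4 i) * d i k) s3.
    have e w : eps k w * (eps i w * eps j w * lin s4 w) =
      lin s4 w * (eps i w * eps j w * eps k w) by ring.
    have [a1 a2] := h4 i j k; split.
      by move: a1; apply: eq_integrable => // w _; rewrite e.
    rewrite (eq_Rintegral _ (fun w _ => e w)) a2; ring.
  split=> //; rewrite h2.
  under eq_bigr do rewrite !mulrDr; rewrite !big_split /= !dE (cE _ (coef s4)).
  rewrite /cdot; ring.
have h2 i : P.-integrable setT (fun w => (lin s2 w * (eps i w * lin s3 w * lin s4 w))%:E) /\
  \int[P]_w (lin s2 w * (eps i w * lin s3 w * lin s4 w)) =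
   coef s2 i * cdot s3 s4 + coef s3 i * cdot s2 s4 + coef s4 i * cdot s2 s3 +
    q * coef s2 i * coef s3 i * coef s4 i.
  have [j|b1 b2] := @lin_mulE (fun w => eps i w * lin s3 w * lin s4 w)
    (fun j => cdot s3 s4 * d i j + coef s3 i * coef s4 j + coef s4 i * coef s3 j +
       (q * coef s3 i * coef s4 i) * d i j) s2.
    have e w : eps j w * (eps i w * lin s3 w * lin s4 w) =
      lin s3 w * (eps i w * eps j w * lin s4 w) by ring.
    have [a1 a2] := h3 i j; split.
      by move: a1; apply: eq_integrable => // w _; rewrite e.
    rewrite (eq_Rintegral _ (fun w _ => e w)) a2; ring.
  split=> //; rewrite b2.
  under eq_bigr do rewrite !mulrDr.
  rewrite !big_split /= !dE (cE _ (coef s4)) (cE _ (coef s3)).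
  rewrite /cdot; ring.
have [i|b1 b2] := @lin_mulE (fun w => lin s2 w * lin s3 w * lin s4 w)
    (fun i => cdot s3 s4 * coef s2 i + cdot s2 s4 * coef s3 i + cdot s2 s3 * coef s4 i +
       q * (coef s2 i * coef s3 i * coef s4 i)) s1.
  have e w : eps i w * (lin s2 w * lin s3 w * lin s4 w) =
    lin s2 w * (eps i w * lin s3 w * lin s4 w) by ring.
  have [a1 a2] := h2 i; split.
    by move: a1; apply: eq_integrable => // w _; rewrite e.
  rewrite (eq_Rintegral _ (fun w _ => e w)) a2; ring.
have e w : lin s1 w * lin s2 w * lin s3 w * lin s4 w =
   lin s1 w * (lin s2 w * lin s3 w * lin s4 w) by ring.
split; first by move: b1; apply: eq_integrable => // w _; rewrite e.
rewrite (eq_Rintegral _ (fun w _ => e w)) b2.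
under eq_bigr do rewrite !mulrDr.
rewrite !big_split /= (cE _ (coef s2)) (cE _ (coef s3)) (cE _ (coef s4)).
rewrite (cE _ (fun m => coef s2 m * coef s3 m * coef s4 m)).
rewrite /cdot /cdot4; ring.
Qed.

End linear_form_moments.

(** * Truncated fractional processes *)

(** The forms below are Y_j, X_n and S_n = X_n + X_(n-1) with the moving average
    cut after N terms.  All bounds are uniform in N. *)
Section fractional_forms.
Variables (R : realType) (al : R).
Hypotheses (al_gt0 : 0 < al) (al_lt : al < 2^-1).
Local Notation a := (binom_coef al).
Local Notation b := (binom_psum al).

Definition yform N (j : int) : seq (R * int) :=
  [seq (a i, j - i%:Z) | i <- iota 0 N].

Definition xform N n : seq (R * int) :=
  flatten [seq yform N j%:Z | j <- iota 1 n].

Definition sform N n : seq (R * int) := xform N n ++ xform N n.-1.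

Lemma l1norm_yform N j : l1norm (yform N j) <= 2.
Proof.
rewrite /l1norm big_map /= -[N in iota 0 N]subn0 big_mkord.
exact: sum_norm_binom_coef.
Qed.

Lemma coef_yform N j m : coef (yform N j) m = \sum_(i < N) a i * (j - i%:Z == m)%:R.
Proof.
rewrite /coef big_map /= -[N in iota 0 N]subn0 big_mkord big_mkcond.
by apply: eq_bigr => i _; case: eqP; rewrite ?mulr1 ?mulr0.
Qed.

Lemma coef_xform N n m :
  coef (xform N n) m = \sum_(i < N) a i * ((1 <= m + i%:Z)%R && (m + i%:Z <= n%:Z)%R)%:R.
Proof.
rewrite coef_flatten big_map.
under eq_bigr do rewrite coef_yform.
rewrite exchange_big /=; apply: eq_bigr => i _; rewrite -mulr_sumr; congr (_ * _).
elim: n => [|n IH].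
  by rewrite big_nil; case: (boolP (_ && _)) => // /andP[h1 h2]; lia.
have -> : iota 1 n.+1 = iota 1 n ++ [:: n.+1].
  by rewrite -[n.+1 in LHS]addn1 iotaD add1n.
rewrite big_cat /= {}IH big_seq1.
rewrite -natrD; congr (_%:R); lia.
Qed.

Lemma norm_coef_xform N n m : `|coef (xform N n) m| <= 2.
Proof.
rewrite coef_xform (le_trans (ler_norm_sum _ _ _))//.
apply: le_trans (sum_norm_binom_coef al_gt0 al_lt N).
apply: ler_sum => i _; rewrite normrM ler_piMr//.
by case: (_ && _); rewrite ?normr1 ?normr0 ?ler01.
Qed.

Lemma norm_coef_sform N n m : `|coef (sform N n) m| <= 4.
Proof.
rewrite coef_cat (le_trans (ler_normD _ _))//.
rewrite [leRHS](_ : _ = 2 + 2); last by ring.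
by rewrite lerD ?norm_coef_xform.
Qed.

(** The innovation at time n - k has entered Y_(n-k), ..., Y_n with weights
    a_0, ..., a_k. *)
Lemma coef_xform_psum N n k : (k < n)%N -> (n <= N)%N ->
  coef (xform N n) (n%:Z - k%:Z) = b k.
Proof.
move=> kn nN; rewrite coef_xform -(sum_binom_coef al k).
rewrite (big_ord_widen _ (fun i => a i) (leq_trans kn nN)) [RHS]big_mkcond.
apply: eq_bigr => i _; rewrite ltnS.
have -> : ((1 <= n%:Z - k%:Z + i%:Z)%R && (n%:Z - k%:Z + i%:Z <= n%:Z)%R) =
    (i <= k)%N by lia.
by case: ifP; rewrite ?mulr1 ?mulr0.
Qed.

Lemma coef_xform_out N n m : n%:Z < m -> coef (xform N n) m = 0.
Proof.
move=> nm; rewrite coef_xform big1// => i _.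
have -> : ((1 <= m + i%:Z)%R && (m + i%:Z <= n%:Z)%R) = false by lia.
by rewrite mulr0.
Qed.

Lemma coef_sform_ge N n k : (k < n)%N -> (n <= N)%N ->
  b k <= coef (sform N n) (n%:Z - k%:Z).
Proof.
move=> kn nN; rewrite coef_cat coef_xform_psum// lerDl.
case: k kn => [|k] kn.
  by rewrite coef_xform_out//; lia.
have -> : n%:Z - k.+1%:Z = n.-1%:Z - k%:Z by lia.
rewrite coef_xform_psum; [|lia|lia].
exact/ltW/binom_psum_gt0.
Qed.

(** Only the innovations at times 1, ..., n are kept: there the weights in X_n
    are the b_k, and those in X_(n-1) are nonnegative. *)
Lemma cdot_sform_ge N n : (n <= N)%N ->
  \sum_(k < n) b k ^+ 2 <= cdot (sform N n) (sform N n).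
Proof.
move=> nN.
pose r : seq int := [seq n%:Z - k%:Z | k <- iota 0 n].
have ur : uniq r by rewrite map_inj_uniq ?iota_uniq// => x y; lia.
apply: le_trans (cdot_ge _ ur).
rewrite big_map /= -[n in iota 0 n]subn0 big_mkord; apply: ler_sum => k _.
by rewrite lerXn2r ?nnegrE ?coef_sform_ge// ?(le_trans _ (coef_sform_ge _ _))//
  ltW// binom_psum_gt0.
Qed.

Lemma norm_cdot_y_s N j n : `|cdot (yform N j) (sform N n)| <= 8.
Proof.
have h := norm_cdot_le (yform N j) (@norm_coef_sform N n).
apply: (le_trans h); rewrite [leRHS](_ : _ = 2 * 4); last by ring.
by rewrite ler_wpM2r// l1norm_yform.
Qed.

Lemma norm_cdot4_ysys N j n k m :
  `|cdot4 (yform N j) (sform N n) (yform N k) (sform N m)| <= 64.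
Proof.
have yM l p : `|coef (yform N l) p| <= 2.
  exact: le_trans (norm_coef_le _ _) (l1norm_yform _ _).
have h := norm_cdot4_le (yform N j) (@norm_coef_sform N n) (yM k) (@norm_coef_sform N m).
apply: (le_trans h); rewrite [leRHS](_ : _ = 2 * (4 * 2 * 4)); last by ring.
by rewrite ler_wpM2r// l1norm_yform.
Qed.

Lemma cdot_yform N i j : cdot (yform N i) (yform N j) =
  \sum_(p < N) \sum_(q < N) a p * a q * (i + q%:Z == j + p%:Z)%:R.
Proof.
rewrite /cdot big_map /= -[N in iota 0 N]subn0 big_mkord.
apply: eq_bigr => p _; rewrite coef_yform mulr_sumr; apply: eq_bigr => q _.
rewrite mulrA; congr (_ * (_%:R)).
by congr nat_of_bool; apply/eqP/eqP; lia.
Qed.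

Lemma cdot_yform_stationary N i h :
  cdot (yform N i) (yform N (i + h)) = cdot (yform N 0) (yform N h).
Proof.
rewrite !cdot_yform; apply: eq_bigr => p _; apply: eq_bigr => q _.
by congr (_ * _%:R); congr nat_of_bool; apply/eqP/eqP; lia.
Qed.

(** The innovation at time i itself has weight a_0 = 1. *)
Lemma cdot_yform_ge1 N i : (0 < N)%N -> 1 <= cdot (yform N i) (yform N i).
Proof.
move=> N0; have := @cdot_ge _ (yform N i) [:: i] isT.
apply: le_trans; rewrite big_seq1 coef_yform.
rewrite (bigD1 (Ordinal N0)) //= big1 ?addr0 => [|k].
  by rewrite eqxx mulr1 /binom_coef big_ord0 expr1n.
rewrite -val_eqE /= => k0.
have -> : (i - (k : nat)%:Z == i) = false by apply/eqP; lia.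
by rewrite mulr0.
Qed.

End fractional_forms.

(** * Domination in fourth power *)

Section weighted_power_mean.
Variable R : realType.

Lemma weighted_sqr_le (I : Type) (s : seq I) (w x : I -> R) :
  (forall i, 0 <= w i) ->
  (\sum_(i <- s) w i * x i) ^+ 2 <=
  (\sum_(i <- s) w i) * \sum_(i <- s) w i * x i ^+ 2.
Proof.
move=> w0; elim: s => [|i s IH]; first by rewrite !big_nil expr0n mul0r.
rewrite !big_cons; move: IH (w0 i).
have : 0 <= \sum_(j <- s) w j by apply: sumr_ge0.
have : 0 <= \sum_(j <- s) w j * x j ^+ 2.
  by apply: sumr_ge0 => j _; rewrite mulr_ge0 ?sqr_ge0.
move: (\sum_(j <- s) w j) (\sum_(j <- s) w j * x j) (\sum_(j <- s) _) => W A Q.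
move: (w i) (x i) => v y Q0 W0 IH v0.
(* a quadratic in y whose discriminant is nonpositive by induction *)
suff h : 0 <= W * y ^+ 2 - 2 * A * y + Q.
  have := mulr_ge0 v0 h; nra.
move: W0; rewrite le_eqVlt => /orP[/eqP W0|W0].
  have A0 : A = 0.
    apply/eqP; rewrite -sqrf_eq0; apply/eqP/le_anti.
    by rewrite sqr_ge0 andbT (le_trans IH)// -W0 mul0r.
  by rewrite -W0 A0 mul0r mulr0 mul0r subr0 add0r.
rewrite -(pmulr_rge0 _ W0).
have -> : W * (W * y ^+ 2 - 2 * A * y + Q) = (W * y - A) ^+ 2 + (W * Q - A ^+ 2).
  ring.
by rewrite addr_ge0 ?sqr_ge0// subr_ge0.
Qed.

(** Jensen's inequality for the fourth power, obtained by squaring twice. *)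
Lemma weighted_pow4_le (I : Type) (s : seq I) (w x : I -> R) :
  (forall i, 0 <= w i) ->
  (\sum_(i <- s) w i * x i) ^+ 4 <=
  (\sum_(i <- s) w i) ^+ 3 * \sum_(i <- s) w i * x i ^+ 4.
Proof.
move=> w0; have W0 : 0 <= \sum_(i <- s) w i by exact: sumr_ge0.
have h1 := weighted_sqr_le s x w0.
have h2 := weighted_sqr_le s (fun i => x i ^+ 2) w0.
have e4 y : y ^+ 4 = (y ^+ 2) ^+ 2 :> R by rewrite -exprM.
have e i : w i * x i ^+ 4 = w i * (x i ^+ 2) ^+ 2 by rewrite e4.
rewrite (eq_bigr _ (fun i _ => e i)) e4 [_ ^+ 3]exprSr -[leRHS]mulrA.
apply: (@le_trans _ _ (((\sum_(i <- s) w i) * \sum_(i <- s) w i * x i ^+ 2) ^+ 2)).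
  apply: lerXn2r; rewrite ?nnegrE ?sqr_ge0// (le_trans _ h1) ?sqr_ge0//.
by rewrite exprMn ler_wpM2l ?sqr_ge0.
Qed.

End weighted_power_mean.

Section fourth_power_approximation.
Context (disp : measure_display) (T : measurableType disp) (R : realType).
Variable P : probability T R.

(** Almost sure convergence with an integrable bound on the fourth powers: the
    products of at most four such sequences are then dominated. *)
Definition approx4 (U_ : nat -> T -> R) (U : T -> R) : Prop :=
  [/\ forall n, measurable_fun setT (U_ n), measurable_fun setT U,
      {ae P, forall w, U_ n w @[n --> \oo] --> U w} &
      exists2 H : T -> \bar R, P.-integrable setT H &
        forall n w, ((U_ n w ^+ 4)%:E <= H w)%E].

Lemma approx4_cst (c : R) : approx4 (fun=> cst c) (cst c).
Proof.
split=> //.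
  by apply: aeW => w; exact: cvg_cst.
exists (cst (c ^+ 4)%:E) => //.
exact: finite_measure_integrable_cst.
Qed.

Lemma approx4D U_ U V_ V : approx4 U_ U -> approx4 V_ V ->
  approx4 (fun n w => U_ n w + V_ n w) (fun w => U w + V w).
Proof.
move=> [mU_ mU cU [H iH UH]] [mV_ mV cV [G iG VG]]; split.
- by move=> n; exact: measurable_funD.
- exact: measurable_funD.
- by apply: filterS2 cU cV => w; exact: cvgD.
exists (fun w => 8%:E * (H w + G w))%E.
  by apply: integrableZl => //; exact: integrableD.
move=> n w; apply: (@le_trans _ _ (8 * ((U_ n w) ^+ 4 + (V_ n w) ^+ 4))%:E).
  rewrite lee_fin; move: (U_ n w) (V_ n w) => u v.
  (* 8 (u^4 + v^4) - (u + v)^4 vanishes doubly at u = v *)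
  suff : 0 <= (u - v) ^+ 2 * (7 * u ^+ 2 + 10 * u * v + 7 * v ^+ 2).
    rewrite -subr_ge0 => h; rewrite [leRHS](_ : _ =
      (u - v) ^+ 2 * (7 * u ^+ 2 + 10 * u * v + 7 * v ^+ 2))//; ring.
  rewrite mulr_ge0 ?sqr_ge0//; have := sqr_ge0 (u + v); have := sqr_ge0 u; have := sqr_ge0 v; nra.
by rewrite EFinM lee_pmul2l// EFinD leeD.
Qed.

(** |u v x z| <= u^4 + v^4 + x^4 + z^4, so dominated convergence applies.  Lower
    order moments are the case of constant factors. *)
Lemma approx4_cvg U_ U V_ V W_ W Z_ Z :
  approx4 U_ U -> approx4 V_ V -> approx4 W_ W -> approx4 Z_ Z ->
  P.-integrable setT (fun w => (U w * V w * W w * Z w)%:E) /\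
  (\int[P]_w (U_ n w * V_ n w * W_ n w * Z_ n w)) @[n --> \oo] -->
    \int[P]_w (U w * V w * W w * Z w).
Proof.
move=> [mU_ mU cU [H1 iH1 UH]] [mV_ mV cV [H2 iH2 VH]].
move=> [mW_ mW cW [H3 iH3 WH]] [mZ_ mZ cZ [H4 iH4 ZH]].
pose H w := (H1 w + H2 w + H3 w + H4 w)%E.
have iH : P.-integrable setT H.
  by do 3 (apply: integrableD => //).
pose f_ n w := (U_ n w * V_ n w * W_ n w * Z_ n w)%:E.
pose f w := (U w * V w * W w * Z w)%:E.
have mf_ n : measurable_fun setT (f_ n).
  by apply/measurable_EFinP; do 3 (apply: measurable_funM => //).
have mf : measurable_fun setT f.
  by apply/measurable_EFinP; do 3 (apply: measurable_funM => //).
have cf : {ae P, forall w, [set: T] w -> f_ n w @[n --> \oo] --> f w}.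
  have cUV : {ae P, forall w, U_ n w * V_ n w @[n --> \oo] --> U w * V w}.
    by apply: filterS2 cU cV => w; exact: cvgM.
  have cWZ : {ae P, forall w, W_ n w * Z_ n w @[n --> \oo] --> W w * Z w}.
    by apply: filterS2 cW cZ => w; exact: cvgM.
  apply: filterS2 cUV cWZ => w c1 c2 _.
  apply: cvg_EFin; first exact: nearW.
  rewrite -[X in _ --> X]mulrA.
  have -> : fine \o f_ ^~ w = (U_ ^~ w \* V_ ^~ w) \* (W_ ^~ w \* Z_ ^~ w).
    by apply/funext => n; rewrite /f_ /= mulrA.
  exact: (cvgM c1 c2).
have fH : {ae P, forall w n, [set: T] w -> (`|f_ n w| <= H w)%E}.
  apply: aeW => w n _; rewrite /f_ /H.
  apply: (@le_trans _ _ (U_ n w ^+ 4 + V_ n w ^+ 4 + W_ n w ^+ 4 + Z_ n w ^+ 4)%:E).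
    rewrite abse_EFin lee_fin; move: (U_ n w) (V_ n w) (W_ n w) (Z_ n w) => u v x z.
    have e4 y : y ^+ 4 = (y ^+ 2) ^+ 2 :> R by rewrite -exprM.
    have sq (p q : R) : `|p * q| <= p ^+ 2 + q ^+ 2 by rewrite ler_norml; nra.
    rewrite -mulrA; apply: le_trans (sq _ _) _.
    have sq2 (p q : R) : (p * q) ^+ 2 <= p ^+ 4 + q ^+ 4.
      rewrite !e4 exprMn; have := sqr_ge0 (p ^+ 2 - q ^+ 2).
      by have := sqr_ge0 (p ^+ 2); have := sqr_ge0 (q ^+ 2); nra.
    by rewrite -addrA lerD ?sq2.
  by rewrite !EFinD; do 3 (apply: leeD => //).
have [i1 _ i3] := dominated_convergence measurableT mf_ mf cf iH fH.
split=> //; rewrite /Rintegral.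
by apply: fine_cvg; rewrite fineK//; exact: integrable_fin_num.
Qed.

End fourth_power_approximation.

(** * The process and the differences of its square *)

Section second_order.
Context (disp : measure_display) (T : measurableType disp) (R : realType).
Variable P : probability T R.

Lemma integrable_sqr_Lfun2 (f : T -> R) : measurable_fun setT f ->
  P.-integrable setT (fun w => (f w * f w)%:E) -> f \in Lfun P 2%:E.
Proof.
move=> mf /integrableP[_ fi]; rewrite inE; apply/andP; split; rewrite inE//=.
rewrite /finite_norm unlock /Lnorm poweR_lty//.
apply: le_lt_trans fi; rewrite le_eqVlt; apply/orP; left; apply/eqP.
apply: eq_integral => w _ /=.
by rewrite powR_mulrn// normrM -expr2.
Qed.

Lemma covariance_Rintegral (U V : T -> R) :
  P.-integrable setT (EFin \o U) -> P.-integrable setT (EFin \o V) ->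
  P.-integrable setT (fun w => (U w * V w)%:E) ->
  covariance P U V = (\int[P]_w (U w * V w) -
     (\int[P]_w U w) * \int[P]_w V w)%:E.
Proof.
move=> iU iV iUV; rewrite covarianceE; [|exact/Lfun1_integrable..].
rewrite unlock EFinB EFinM /Rintegral !fineK//; exact: integrable_fin_num.
Qed.

End second_order.

Lemma bounded_error_ratio_cvg (R : realType) (u v : nat -> R) (g C : R) :
  v n @[n --> \oo] --> +oo -> (forall n, `|u n - g * v n| <= C) ->
  u n / v n @[n --> \oo] --> g.
Proof.
move=> vy uC; have C0 : 0 <= C by apply: le_trans (uC 0%N).
apply/cvgrPdist_le => e e0; near=> n.
have v0 : 0 < v n by near: n; exact: (cvgry_gt vy 0).
have vC : C / e <= v n by near: n; exact: (cvgry_ge vy (C / e)).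
have -> : g - u n / v n = - ((u n - g * v n) / v n) by field; rewrite gt_eqF.
rewrite normrN normrM normfV (gtr0_norm v0) ler_pdivrMr//.
by rewrite (le_trans (uC n))// mulrC -ler_pdivrMr.
Unshelve. all: by end_near. Qed.

Section fractional_process.
Context (disp : measure_display) (T : measurableType disp) (R : realType).
Variable P : probability T R.
Variables (al : R) (eps : int -> {RV P >-> R}).
Hypotheses (al_gt0 : 0 < al) (al_lt : al < 2^-1).
Hypothesis eps_indep : mutually_independent P eps.
Hypothesis eps_id : identically_distributed P eps.
Hypothesis eps_mean : forall i, ('E_P[eps i] = 0)%E.
Hypothesis eps_var : forall i, ('V_P[eps i] = 1)%E.
Hypothesis eps_4 : ('E_P[fun w => (eps 1 w ^+ 4)%R] < +oo)%E.
Variable Y : int -> {RV P >-> R}.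
Hypothesis Y_def : linear_process P (binom_coef al) eps Y.
Local Notation a := (binom_coef al).

Lemma lin_yformE N j w :
  lin eps (yform al N j) w = \sum_(i < N) a i * eps (j - i%:Z) w.
Proof. by rewrite /lin big_map /= -[N in iota 0 N]subn0 big_mkord. Qed.

(** With weights |a_i| of total mass at most 2, the fourth power of any partial
    sum is at most 8 \sum_i |a_i| eps_(j - i)^4, whose expectation is finite
    because fourth moments are bounded and the a_i are summable. *)
Lemma approx4_yform j : approx4 P (fun N => lin eps (yform al N j)) (Y j).
Proof.
split.
- by move=> N; exact: measurable_lin.
- exact: measurable_funP.
- apply: filterS (Y_def j) => w; rewrite /series.
  suff -> : (fun N => lin eps (yform al N j) w) =
    (fun n => \sum_(0 <= k < n) a k * eps (j - k%:Z) w) by [].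
  by apply/funext => N; rewrite lin_yformE big_mkord.
pose h (i : nat) w : \bar R := (`|a i| * eps (j - i%:Z) w ^+ 4)%:E.
have h0 i w : (0 <= h i w)%E.
  by rewrite lee_fin mulr_ge0// exprn_even_ge0.
have mh i : measurable_fun setT (h i).
  by apply/measurable_EFinP/measurable_funM => //; exact: measurable_funX.
have hs w n : (\sum_(i < n) h i w <= \sum_(i <oo) h i w)%E.
  rewrite -(big_mkord xpredT (fun i => h i w)).
  by apply: nneseries_lim_ge => i _.
exists (fun w => 8%:E * \sum_(i <oo) h i w)%E.
  apply: integrableZl => //; apply/integrableP; split.
    exact: ge0_emeasurable_sum.
  under eq_integral do rewrite gee0_abs ?nneseries_ge0//.
  rewrite integral_nneseries//.
  apply: (@le_lt_trans _ _ (2 * moment eps 4)%:E); last by rewrite ltry.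
  apply: lime_le; first by apply: is_cvg_nneseries => n _ *; apply: integral_ge0 => w _; exact: h0.
  apply: nearW => n; rewrite big_mkord.
  have e i : (\int[P]_w h i w)%E = (`|a i| * moment eps 4)%:E.
    have i4 := integrable_eps_pow eps_id eps_4 (j - i%:Z) (leqnn 4).
    rewrite -(moment_eps eps_id eps_4 (j - i%:Z) (leqnn 4)) -RintegralZl//.
    rewrite /Rintegral fineK//; apply: integrable_fin_num => //.
    by have := integrableZl measurableT `|a i| i4; apply: eq_integrable.
  rewrite (eq_bigr _ (fun (i : 'I_n) _ => e i)) sumEFin lee_fin -mulr_suml.
  rewrite ler_wpM2r ?sum_norm_binom_coef//.
  by apply: Rintegral_ge0 => w _; rewrite exprn_even_ge0.
move=> n w; apply: (@le_trans _ _ (8 * \sum_(i < n) h i w)%E); last first.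
  by rewrite lee_pmul2l.
rewrite sumEFin -EFinM lee_fin lin_yformE.
set s := \sum_(i < n) a i * _.
have e4 : s ^+ 4 = `|s| ^+ 4 by rewrite -normrX ger0_norm// exprn_even_ge0.
rewrite e4; apply: (@le_trans _ _ ((\sum_(i < n) `|a i| * `|eps (j - (i : nat)%:Z) w|) ^+ 4)).
  rewrite lerXn2r ?nnegrE//; first by apply: sumr_ge0 => i _; rewrite mulr_ge0.
  by rewrite (le_trans (ler_norm_sum _ _ _))//; apply: ler_sum => i _; rewrite normrM.
have := weighted_pow4_le (index_enum 'I_n) (fun i : 'I_n => `|eps (j - (i : nat)%:Z) w|)
  (fun i : 'I_n => normr_ge0 (a i)).
move=> /le_trans; apply.
have -> : \sum_(i < n) `|a i| * `|eps (j - (i : nat)%:Z) w| ^+ 4 =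
  \sum_(i < n) `|a i| * eps (j - (i : nat)%:Z) w ^+ 4.
  by apply: eq_bigr => i _; rewrite -normrX (ger0_norm (exprn_even_ge0 _ _)).
apply: ler_wpM2r.
  by apply: sumr_ge0 => i _; apply: mulr_ge0 => //; exact: exprn_even_ge0.
rewrite [leRHS](_ : _ = 2 ^+ 3); last by ring.
by rewrite lerXn2r ?nnegrE ?sumr_ge0// sum_norm_binom_coef.
Qed.

(** The processes X_n, and S_n = X_n + X_(n-1). *)
Definition psumY (n : nat) (w : T) : R := \sum_(1 <= j < n.+1) Y j%:Z w.
Definition psumY2 (n : nat) (w : T) : R := psumY n w + psumY n.-1 w.

Lemma psumYS n w : psumY n.+1 w = psumY n w + Y n.+1%:Z w.
Proof. by rewrite /psumY big_nat_recr. Qed.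

Lemma approx4_xform n : approx4 P (fun N => lin eps (xform al N n)) (psumY n).
Proof.
elim: n => [|n IH].
  have -> : psumY 0 = cst 0 by apply/funext => w; rewrite /psumY big_geq.
  have -> : (fun N => lin eps (xform al N 0)) = (fun=> cst 0).
    by apply/funext => N; apply/funext => w; rewrite /lin big_nil.
  exact: approx4_cst.
have -> : psumY n.+1 = (fun w => psumY n w + Y n.+1%:Z w).
  by apply/funext => w; rewrite psumYS.
have -> : (fun N => lin eps (xform al N n.+1)) =
   (fun N w => lin eps (xform al N n) w + lin eps (yform al N n.+1%:Z) w).
  apply/funext => N; apply/funext => w; rewrite -lin_cat; congr (lin eps _ w).
  rewrite /xform -[X in iota 1 X]addn1 iotaD map_cat flatten_cat.
  by rewrite /= cats0 add1n.
by apply: approx4D IH _; exact: approx4_yform.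
Qed.

Lemma approx4_sform n : approx4 P (fun N => lin eps (sform al N n)) (psumY2 n).
Proof.
have -> : (fun N => lin eps (sform al N n)) =
   (fun N w => lin eps (xform al N n) w + lin eps (xform al N n.-1) w).
  by apply/funext => N; apply/funext => w; rewrite -lin_cat.
by apply: approx4D; exact: approx4_xform.
Qed.

Section limits_of_forms.
Variables (s1 s2 s3 s4 : nat -> seq (R * int)) (U V W Z : T -> R).
Hypotheses (hU : approx4 P (fun N => lin eps (s1 N)) U)
  (hV : approx4 P (fun N => lin eps (s2 N)) V)
  (hW : approx4 P (fun N => lin eps (s3 N)) W)
  (hZ : approx4 P (fun N => lin eps (s4 N)) Z).

Lemma approx4_mean : P.-integrable setT (EFin \o U) /\ \int[P]_w U w = 0.
Proof.
have c1 := approx4_cst P 1.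
have [i c] := approx4_cvg hU c1 c1 c1.
have e (f : T -> R) w : f w * cst 1 w * cst 1 w * cst 1 w = f w.
  by rewrite !mulr1.
split; first by move: i; apply: eq_integrable => // w _; rewrite e.
rewrite (eq_Rintegral _ (fun w _ => e U w)) in c.
move: c; rewrite (_ : (fun n => _) = (fun=> 0)).
  by move/(cvg_unique _); apply => //; exact: cvg_cst.
apply/funext => N; rewrite (eq_Rintegral _ (fun w _ => e (lin eps (s1 N)) w)).
exact: lin_mean.
Qed.

Lemma approx4_cdot : P.-integrable setT (fun w => (U w * V w)%:E) /\
  cdot (s1 N) (s2 N) @[N --> \oo] --> \int[P]_w (U w * V w).
Proof.
have c1 := approx4_cst P 1.
have [i c] := approx4_cvg hU hV c1 c1.
have e (f g : T -> R) w : f w * g w * cst 1 w * cst 1 w = f w * g w.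
  by rewrite !mulr1.
split; first by move: i; apply: eq_integrable => // w _; rewrite e.
rewrite (eq_Rintegral _ (fun w _ => e U V w)) in c.
move: c; rewrite (_ : (fun n => _) = (fun N => cdot (s1 N) (s2 N)))//.
apply/funext => N; rewrite (eq_Rintegral _ (fun w _ => e (lin eps (s1 N)) (lin eps (s2 N)) w)).
by have [] := lin_moment2 eps_indep eps_id eps_mean eps_var eps_4 (s1 N) (s2 N).
Qed.

Lemma approx4_moment4 : P.-integrable setT (fun w => (U w * V w * W w * Z w)%:E) /\
  cdot (s1 N) (s2 N) * cdot (s3 N) (s4 N) +
  cdot (s1 N) (s3 N) * cdot (s2 N) (s4 N) +
  cdot (s1 N) (s4 N) * cdot (s2 N) (s3 N) +
  excess eps * cdot4 (s1 N) (s2 N) (s3 N) (s4 N) @[N --> \oo] -->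
  \int[P]_w (U w * V w * W w * Z w).
Proof.
have [i c] := approx4_cvg hU hV hW hZ; split=> //.
rewrite (_ : (fun N => _ + _) = (fun N => \int[P]_w (lin eps (s1 N) w *
  lin eps (s2 N) w * lin eps (s3 N) w * lin eps (s4 N) w)))//.
apply/funext => N.
by have [] := lin_moment4 eps_indep eps_id eps_mean eps_var eps_4 (s1 N) (s2 N) (s3 N) (s4 N).
Qed.

End limits_of_forms.

(** These mixed second moments are covariances, all variables being centered. *)
Definition covY (i j : int) : R := \int[P]_w (Y i w * Y j w).
Definition covS (n m : nat) : R := \int[P]_w (psumY2 n w * psumY2 m w).
Definition covYS (j : int) (n : nat) : R := \int[P]_w (Y j w * psumY2 n w).

Lemma cvg_covY i j : cdot (yform al N i) (yform al N j) @[N --> \oo] --> covY i j.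
Proof. by have [] := approx4_cdot (approx4_yform i) (approx4_yform j). Qed.

Lemma cvg_covS n m : cdot (sform al N n) (sform al N m) @[N --> \oo] --> covS n m.
Proof. by have [] := approx4_cdot (approx4_sform n) (approx4_sform m). Qed.

Lemma cvg_covYS j n : cdot (yform al N j) (sform al N n) @[N --> \oo] --> covYS j n.
Proof. by have [] := approx4_cdot (approx4_yform j) (approx4_sform n). Qed.

Lemma covY_stationary i h : covY i (i + h) = covY 0 h.
Proof.
have c := @cvg_covY i (i + h); apply/(cvg_unique _ c) => //.
have -> : (fun N => cdot (yform al N i) (yform al N (i + h))) =
  (fun N => cdot (yform al N 0) (yform al N h)).
  by apply/funext => N; rewrite cdot_yform_stationary.
exact: cvg_covY.
Qed.

Lemma covY_ge1 i : 1 <= covY i i.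
Proof.
apply: (cvgr_to_ge (@cvg_covY i i)).
by exists 1%N => // N /= N0; exact: cdot_yform_ge1.
Qed.

Lemma norm_covYS j n : `|covYS j n| <= 8.
Proof.
apply: (cvgr_to_le (cvg_norm (@cvg_covYS j n))).
by apply: nearW => N; exact: norm_cdot_y_s.
Qed.

Lemma covS_ge n : \sum_(k < n) binom_psum al k ^+ 2 <= covS n n.
Proof.
apply: (cvgr_to_ge (@cvg_covS n n)).
by exists n => // N /= nN; exact: cdot_sform_ge.
Qed.

Lemma covS_cvgy : covS n n @[n --> \oo] --> +oo.
Proof.
apply: (ger_cvgy _ (sum_binom_psum_sqr_cvgy al_gt0 al_lt)).
by apply: nearW => n; exact: covS_ge.
Qed.

Lemma covSC n m : covS n m = covS m n.
Proof. by apply: eq_Rintegral => w _; rewrite mulrC. Qed.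

(** S_(m+1) - S_m = Y_(m+1) + Y_m, and Cov (Y_j, S_n) is bounded. *)
Lemma covS_step n m : `|covS n m.+1 - covS n m| <= 16.
Proof.
have iS p q := (approx4_cdot (approx4_sform p) (approx4_sform q)).1.
have iY j p := (approx4_cdot (approx4_yform j) (approx4_sform p)).1.
rewrite /covS -(RintegralB measurableT (iS n m.+1) (iS n m)).
(* S_0 = X_0 = 0 involves no innovation, hence S_1 - S_0 = Y_1 alone *)
pose y0 w := if m is 0%N then 0 else Y m%:Z w.
have e w : psumY2 n w * psumY2 m.+1 w - psumY2 n w * psumY2 m w =
   Y m.+1%:Z w * psumY2 n w + y0 w * psumY2 n w.
  rewrite -mulrBr -mulrDl mulrC; congr (_ * _).
  rewrite /psumY2 /y0 psumYS /=.
  by case: (m) => [|k] /=; [|rewrite psumYS]; ring.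
have i0 : P.-integrable setT (fun w => (y0 w * psumY2 n w)%:E).
  rewrite /y0; case: (m) => [|k]; last exact: iY.
  by under eq_fun do rewrite /= mul0r; exact: integrable0.
rewrite (eq_Rintegral _ (fun w _ => e w)) (RintegralD measurableT (iY m.+1 n) i0).
rewrite [leRHS](_ : _ = 8 + 8); last by ring.
apply: le_trans (ler_normD _ _) _.
apply: lerD; first exact: norm_covYS.
rewrite /y0; case: (m) => [|k]; last exact: norm_covYS.
under eq_Rintegral do rewrite mul0r.
by rewrite /Rintegral integral0 normr0.
Qed.

Lemma covS_shift n m h : `|covS n (m + h) - covS n m| <= 16 * h%:R.
Proof.
elim: h => [|h IH]; first by rewrite addn0 subrr normr0 mulr0.
rewrite addnS -[h.+1%:R]natr1 mulrDr mulr1 [leRHS]addrC.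
have -> : covS n (m + h).+1 - covS n m = (covS n (m + h).+1 - covS n (m + h)) +
  (covS n (m + h) - covS n m) by ring.
by apply: le_trans (ler_normD _ _) _; rewrite lerD// covS_step.
Qed.

(** This is D_n = X_n^2 - X_(n-1)^2; at n = 0 it vanishes with S_0. *)
Definition prodYS (n : nat) (w : T) : R := Y n%:Z w * psumY2 n w.

Lemma integrable_prodYS n : P.-integrable setT (EFin \o prodYS n).
Proof. by have [] := approx4_cdot (approx4_yform n%:Z) (approx4_sform n). Qed.

Lemma integrable_prodYSM n m :
  P.-integrable setT (fun w => (prodYS n w * prodYS m w)%:E).
Proof.
have [+ _] := approx4_moment4 (approx4_yform n%:Z) (approx4_sform n)
  (approx4_yform m%:Z) (approx4_sform m).
by apply: eq_integrable => // w _; rewrite /prodYS mulrA.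
Qed.

Lemma measurable_prodYS n : measurable_fun setT (prodYS n).
Proof. by case/integrableP: (integrable_prodYS n) => /measurable_EFinP. Qed.

(** Cov (D_n, D_m).  The variables D_n are not centered. *)
Definition covD (n m : nat) : R := \int[P]_w (prodYS n w * prodYS m w) -
  (\int[P]_w prodYS n w) * \int[P]_w prodYS m w.

(** Of the three pairings of Y_n, S_n, Y_m, S_m, the pairing (Y_n S_n)(Y_m S_m)
    cancels with the product of means and (Y_n Y_m)(S_n S_m) is the main term.
    The third one and the cumulant term are bounded, since a factor Y is
    absolutely summable and the coefficients of S are bounded. *)
Lemma covD_approx n m :
  `|covD n m - covY n%:Z m%:Z * covS n m| <= 64 + `|excess eps| * 64.
Proof.
have [_ c] := approx4_moment4 (approx4_yform n%:Z) (approx4_sform n)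
  (approx4_yform m%:Z) (approx4_sform m).
have c1 := cvgM (@cvg_covYS n%:Z n) (@cvg_covYS m%:Z m).
have c2 := cvgM (@cvg_covY n%:Z m%:Z) (@cvg_covS n m).
have c3 := cvg_norm (cvgB (cvgB c (c1 _)) (c2 _)).
have -> : covD n m - covY n%:Z m%:Z * covS n m =
   \int[P]_w (Y n%:Z w * psumY2 n w * Y m%:Z w * psumY2 m w) -
   covYS n%:Z n * covYS m%:Z m - covY n%:Z m%:Z * covS n m.
  rewrite /covD; congr (_ - _ - _).
  by apply: eq_Rintegral => w _; rewrite /prodYS mulrA.
apply: (cvgr_to_le (c3 _ _ _ _ _)); apply: nearW => N /=.
rewrite [X in `|X|](_ : _ = cdot (yform al N n%:Z) (sform al N m) *
    cdot (sform al N n) (yform al N m%:Z) + excess eps *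
    cdot4 (yform al N n%:Z) (sform al N n) (yform al N m%:Z) (sform al N m)).
  rewrite (le_trans (ler_normD _ _))//; apply: lerD.
    rewrite normrM [leRHS](_ : _ = 8 * 8); last by ring.
    by rewrite ler_pM// ?norm_cdot_y_s// cdotC norm_cdot_y_s.
  by rewrite normrM ler_wpM2l// norm_cdot4_ysys.
by rewrite !fctE /=; ring.
Qed.

Lemma covariance_prodYS n m : covariance P (prodYS n) (prodYS m) = (covD n m)%:E.
Proof.
exact: covariance_Rintegral (integrable_prodYS n) (integrable_prodYS m)
  (integrable_prodYSM n m).
Qed.

Lemma corr_prodYS n m : corr P (prodYS n) (prodYS m) =
  covD n m / (Num.sqrt (covD n n) * Num.sqrt (covD m m)).
Proof. by rewrite /corr /variance !covariance_prodYS. Qed.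

Lemma Lfun_prodYS n : prodYS n \in Lfun P 2%:E.
Proof. exact: integrable_sqr_Lfun2 (measurable_prodYS n) (integrable_prodYSM n n). Qed.

(** Both arguments are shifted, so that the covariance at lag h - k and the two
    variances in the correlation are all compared with the same E[S_n^2]. *)
Lemma covD_shift h k n : (k <= h)%N ->
  `|covD (n + k) (n + h) - covY 0 (h - k)%N%:Z * covS n n| <=
  64 + `|excess eps| * 64 + `|covY 0 (h - k)%N%:Z| * (16 * (h + k)%:R).
Proof.
move=> kh; have e : (n + h)%:Z = (n + k)%:Z + (h - k)%N%:Z by lia.
have := covD_approx (n + k) (n + h).
rewrite {1}e covY_stationary; set g := covY 0 _ => h1.
have h2 : `|covS (n + k) (n + h) - covS n n| <= 16 * (h + k)%:R.
  have -> : covS (n + k) (n + h) - covS n n =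
    (covS (n + k) (n + h) - covS (n + k) n) + (covS (n + k) n - covS n n) by ring.
  apply: le_trans (ler_normD _ _) _; rewrite natrD mulrDr lerD ?covS_shift//.
  by rewrite covSC covS_shift.
have -> : covD (n + k) (n + h) - g * covS n n =
  (covD (n + k) (n + h) - g * covS (n + k) (n + h)) +
  g * (covS (n + k) (n + h) - covS n n) by ring.
by apply: le_trans (ler_normD _ _) _; rewrite lerD// normrM ler_wpM2l.
Qed.

(** Numerator and denominator are divided by E[S_n^2], which tends to infinity
    and therefore kills the bounded errors. *)
Lemma corr_prodYS_cvg (h : nat) :
  corr P (prodYS n) (prodYS (n + h)) @[n --> \oo] --> covY 0 h%:Z / covY 0 0.
Proof.
have g0 : 0 < covY 0 0 by apply: lt_le_trans (covY_ge1 0).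
have c1 : covD n (n + h) / covS n n @[n --> \oo] --> covY 0 h%:Z.
  apply: (bounded_error_ratio_cvg covS_cvgy) => n.
  by have := @covD_shift h 0 n (leq0n h); rewrite addn0 subn0; apply.
have c2 : covD n n / covS n n @[n --> \oo] --> covY 0 0.
  apply: (bounded_error_ratio_cvg covS_cvgy) => n.
  by have := @covD_shift 0 0 n isT; rewrite addn0 subn0; apply.
have c3 : covD (n + h) (n + h) / covS n n @[n --> \oo] --> covY 0 0.
  apply: (bounded_error_ratio_cvg covS_cvgy) => n.
  by have := @covD_shift h h n (leqnn h); rewrite subnn; apply.
have sc (u : nat -> R) (l : R) :
    u n @[n --> \oo] --> l -> Num.sqrt (u n) @[n --> \oo] --> Num.sqrt l.
  by move=> ul; apply: (cvg_comp u Num.sqrt ul); exact: sqrt_continuous.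
have c4 : Num.sqrt (covD n n / covS n n) *
    Num.sqrt (covD (n + h) (n + h) / covS n n) @[n --> \oo] --> covY 0 0.
  rewrite -[X in _ --> X](sqr_sqrtr (ltW g0)) expr2; apply: cvgM.
    exact: (sc _ _ c2).
  exact: (sc _ _ c3).
have g0' : covY 0 0 != 0 by rewrite gt_eqF.
have c5 : (covD n (n + h) / covS n n) / (Num.sqrt (covD n n / covS n n) *
    Num.sqrt (covD (n + h) (n + h) / covS n n)) @[n --> \oo] -->
    covY 0 h%:Z / covY 0 0.
  by apply: cvgM c1 _; exact: (cvgV g0' c4).
move: c5; apply: cvg_trans; apply: near_eq_cvg; near=> n.
have v0 : 0 < covS n n by near: n; exact: (cvgry_gt covS_cvgy 0).
rewrite corr_prodYS /=.
have sv x : Num.sqrt (x / covS n n) = Num.sqrt x / Num.sqrt (covS n n).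
  by rewrite mulrC sqrtrM ?invr_ge0 ?(ltW v0)// sqrtrV ?(ltW v0)// mulrC.
have t0 : Num.sqrt (covS n n) != 0 by rewrite gt_eqF// sqrtr_gt0.
rewrite !sv !invfM !invrK -[in X in _ * X^-1 * _ = _](sqr_sqrtr (ltW v0)).
move: (Num.sqrt (covD n n))^-1 (Num.sqrt (covD (n + h) (n + h)))^-1 t0 => p q.
by move: (Num.sqrt _) => t t0; field.
Unshelve. all: by end_near. Qed.

Lemma integrable_YM i j : P.-integrable setT (fun w => (Y i w * Y j w)%:E).
Proof. by have [] := approx4_cdot (approx4_yform i) (approx4_yform j). Qed.

Lemma covariance_Y i j : covariance P (Y i) (Y j) = (covY i j)%:E.
Proof.
have [i1 e1] := approx4_mean (approx4_yform i).
have [i2 e2] := approx4_mean (approx4_yform j).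
by rewrite covariance_Rintegral// ?e1 ?mul0r ?subr0//; exact: integrable_YM.
Qed.

Lemma stationary_Y : stationary P Y.
Proof.
split.
- by move=> n; apply: integrable_sqr_Lfun2 => //; exact: integrable_YM.
- have m0 i : ('E_P[Y i])%E = 0%E.
    have [i1 e1] := approx4_mean (approx4_yform i).
    rewrite unlock; move: e1; rewrite /Rintegral => e1.
    by rewrite -(fineK (integrable_fin_num _ i1))// e1.
  by move=> n; rewrite !m0.
- by move=> n h; rewrite !covariance_Y covY_stationary.
Qed.

Lemma corr_Y h : corr P (Y 0) (Y h) = covY 0 h / covY 0 0.
Proof.
have e : covY h h = covY 0 0 by rewrite -[RHS](covY_stationary h) addr0.
rewrite /corr /variance !covariance_Y /= e -expr2 sqr_sqrtr//.
by apply: le_trans (covY_ge1 0).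
Qed.

End fractional_process.

(** * The truncated transfer function on the unit circle *)

(** With z = r e^(il) and A_N (z) = \sum_(i < N) a_i z^i, [cos_sum] and [sin_sum]
    are the real and imaginary parts of A_N (z), and the primed sums are their
    derivatives in r. *)
Section transfer_function.
Variables (R : realType) (al : R).
Hypotheses (al_gt0 : 0 < al) (al_lt : al < 2^-1).
Local Notation a := (binom_coef al).
Local Notation b := (binom_psum al).

Definition cos_sum N (l r : R) : R := \sum_(i < N) a i * cos (i%:R * l) * r ^+ i.
Definition sin_sum N (l r : R) : R := \sum_(i < N) a i * sin (i%:R * l) * r ^+ i.
Definition cos_sum' N (l r : R) : R :=
  \sum_(i < N) a i * cos (i%:R * l) * (i%:R * r ^+ i.-1).
Definition sin_sum' N (l r : R) : R :=
  \sum_(i < N) a i * sin (i%:R * l) * (i%:R * r ^+ i.-1).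

Lemma is_derive_sum_pow (u : nat -> R) N (r : R) :
  is_derive r 1 (fun r => \sum_(i < N) u i * r ^+ i)
    (\sum_(i < N) u i * (i%:R * r ^+ i.-1)).
Proof.
elim: N => [|N IH].
  rewrite big_ord0 (_ : (fun _ => _) = cst 0); last first.
    by apply/funext => x; rewrite big_ord0.
  exact: is_derive_cst.
rewrite big_ord_recr /= (_ : (fun _ => _) =
  (fun r => \sum_(i < N) u i * r ^+ i) + (fun r => u N * r ^+ N)); last first.
  by apply/funext => x; rewrite big_ord_recr.
apply: is_deriveD.
have -> : (fun r : R => u N * r ^+ N) = u N \*: ((@id R) ^+ N).
  by apply/funext => x; rewrite /= exprfctE.
by apply: is_derive_eq; rewrite /GRing.scale /= mulr1.
Qed.

(** |1 - z|^2. *)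
Definition gap_sqr (l r : R) : R := 1 - 2 * r * cos l + r ^+ 2.

Lemma binom_coef_rec k : k.+1%:R * a k.+1 = (k%:R - al) * a k.
Proof.
rewrite /binom_coef big_ord_recr /= mulrCA mulrC; congr (_ * _).
by rewrite mulrC divfK// pnatr_eq0.
Qed.

(** Real and imaginary parts of e^(il) times
      (1 - z) A_N'(z) + al A_N (z) = - N a_N z^(N - 1).
    Without the right-hand side, the equation characterizes (1 - z)^al. *)
Lemma transfer_ode N (l r : R) :
  (1 - r * cos l) * cos_sum' N l r + r * sin l * sin_sum' N l r =
    - al * (cos l * cos_sum N l r - sin l * sin_sum N l r) -
    N%:R * a N * r ^+ N.-1 * cos (N%:R * l) /\
  (1 - r * cos l) * sin_sum' N l r - r * sin l * cos_sum' N l r =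
    - al * (sin l * cos_sum N l r + cos l * sin_sum N l r) -
    N%:R * a N * r ^+ N.-1 * sin (N%:R * l).
Proof.
elim: N => [|N [IH1 IH2]].
  by rewrite /cos_sum /sin_sum /cos_sum' /sin_sum' !big_ord0; split; ring.
have cS : cos (N.+1%:R * l) = cos l * cos (N%:R * l) - sin l * sin (N%:R * l).
  by rewrite -natr1 mulrDl mul1r cosD mulrC [sin _ * _]mulrC.
have sS : sin (N.+1%:R * l) = sin l * cos (N%:R * l) + cos l * sin (N%:R * l).
  by rewrite -natr1 mulrDl mul1r sinD addrC [cos _ * _]mulrC [sin (N%:R * l) * _]mulrC.
have rS : N%:R * r ^+ N = N%:R * r ^+ N.-1 * r.
  by case: (N) => [|k]; [rewrite !mul0r|rewrite exprSr mulrA].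
rewrite binom_coef_rec cS sS /= /cos_sum /sin_sum /cos_sum' /sin_sum'.
rewrite !big_ord_recr /= -/(cos_sum N l r) -/(sin_sum N l r).
rewrite -/(cos_sum' N l r) -/(sin_sum' N l r).
move: IH1 IH2 rS {cS sS}.
move: (cos_sum N l r) (sin_sum N l r) (cos_sum' N l r) (sin_sum' N l r).
move: (N%:R : R) (a N) => n aN.
move: (cos (n * l)) (sin (n * l)) (cos l) (sin l).
move: (r ^+ N) (r ^+ N.-1) => p q cN sN c s C S C' S' IH1 IH2 e.
split.
  transitivity (((1 - r * c) * C' + r * s * S') + aN * (cN - r * (c * cN - s * sN)) * (n * q)).
    ring.
  rewrite IH1.
  transitivity (- al * (c * C - s * S) - aN * (c * cN - s * sN) * (n * q * r)); first ring.
  rewrite -e; ring.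
transitivity (((1 - r * c) * S' - r * s * C') + aN * (sN - r * (s * cN + c * sN)) * (n * q)).
  ring.
rewrite IH2.
transitivity (- al * (s * C + c * S) - aN * (s * cN + c * sN) * (n * q * r)); first ring.
rewrite -e; ring.
Qed.

(** |A_N (z)|^2. *)
Definition transfer_sqr N l r : R := cos_sum N l r ^+ 2 + sin_sum N l r ^+ 2.

(** If A_N solved the homogeneous equation, |A_N|^2 |1 - z|^(-2 al) would be
    constant along the radius; its derivative therefore consists of the
    remainder term only. *)
Lemma is_derive_ratio N (l r : R) : 0 < gap_sqr l r ->
  is_derive r 1 (fun r => transfer_sqr N l r * gap_sqr l r `^ (- al))
   (- 2 * (N%:R * a N * r ^+ N.-1) * gap_sqr l r `^ (- al - 1) *
     (cos_sum N l r * ((1 - r * cos l) * cos (N%:R * l) - r * sin l * sin (N%:R * l)) +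
      sin_sum N l r * (r * sin l * cos (N%:R * l) + (1 - r * cos l) * sin (N%:R * l)))).
Proof.
move=> w0.
have dC : is_derive r 1 (cos_sum N l) (cos_sum' N l r).
  exact: (is_derive_sum_pow (fun i => a i * cos (i%:R * l)) N r).
have dS : is_derive r 1 (sin_sum N l) (sin_sum' N l r).
  exact: (is_derive_sum_pow (fun i => a i * sin (i%:R * l)) N r).
have dw : is_derive r 1 (gap_sqr l) (2 * r - 2 * cos l).
  have -> : gap_sqr l = cst 1 - (2 * cos l) \*: (@id R) + (@id R) ^+ 2.
    apply/funext => x; rewrite /gap_sqr !fctE -[X in _ = _ - X + _]/(2 * cos l * x) /=; ring.
  apply: is_derive_eq.
  transitivity (0 - 2 * cos l * 1 + 2 * r ^+ 1 * 1); [by []|ring].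
have dp : is_derive r 1 ((@powR R ^~ (- al)) \o gap_sqr l)
    ((- al * gap_sqr l r `^ (- al - 1)) * (2 * r - 2 * cos l)).
  exact: (is_derive1_comp (is_derive1_powR (- al) w0) dw).
have -> : (fun r => transfer_sqr N l r * gap_sqr l r `^ (- al)) =
   (cos_sum N l * cos_sum N l + sin_sum N l * sin_sum N l) *
   (@powR R ^~ (- al) \o gap_sqr l).
  by apply/funext => x; rewrite !fctE /transfer_sqr !expr2.
apply: is_derive_eq; rewrite !fctE /GRing.scale /=.
have [ode1 ode2] := transfer_ode N l r.
have csE := cos2Dsin2 l.
have wE : gap_sqr l r = (1 - r * cos l) ^+ 2 + (r * sin l) ^+ 2.
  by rewrite /gap_sqr exprMn sin2cos2; ring.
have -> : gap_sqr l r `^ (- al) = gap_sqr l r * gap_sqr l r `^ (- al - 1).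
  by rewrite -[in LHS](subrK 1 (- al)) powRD ?powRr1 ?(ltW w0) 1?mulrC// (gt_eqF w0) implybT.
have key : gap_sqr l r * (cos_sum N l r * cos_sum' N l r + sin_sum N l r * sin_sum' N l r) =
   cos_sum N l r * ((1 - r * cos l) *
     ((1 - r * cos l) * cos_sum' N l r + r * sin l * sin_sum' N l r) -
     r * sin l * ((1 - r * cos l) * sin_sum' N l r - r * sin l * cos_sum' N l r)) +
   sin_sum N l r * (r * sin l *
     ((1 - r * cos l) * cos_sum' N l r + r * sin l * sin_sum' N l r) +
     (1 - r * cos l) * ((1 - r * cos l) * sin_sum' N l r - r * sin l * cos_sum' N l r)).
  by rewrite wE; ring.
rewrite ode1 ode2 in key; move: key csE {ode1 ode2 wE dC dS dw dp}.
move: (gap_sqr l r `^ (- al - 1)) => z.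
move: (gap_sqr l r) w0 => w w0.
move: (cos_sum N l r) (sin_sum N l r) (cos_sum' N l r) (sin_sum' N l r).
move: (N%:R * a N * r ^+ N.-1) (cos (N%:R * l)) (sin (N%:R * l)) (cos l) (sin l).
move=> e cN sN c s C S C' S' key csE.
transitivity (2 * z * (w * (C * C' + S * S')) - al * z * (C ^+ 2 + S ^+ 2) * (2 * r - 2 * c)).
  by ring.
rewrite key.
transitivity (- 2 * e * z *
  (C * ((1 - r * c) * cN - r * s * sN) + S * (r * s * cN + (1 - r * c) * sN)) +
  2 * al * z * (C ^+ 2 + S ^+ 2) * r * (c ^+ 2 + s ^+ 2 - 1)).
  by ring.
by rewrite csE; ring.
Qed.

End transfer_function.

Section transfer_limit.
Variables (R : realType) (al : R).
Hypotheses (al_gt0 : 0 < al) (al_lt : al < 2^-1).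
Local Notation a := (binom_coef al).
Local Notation b := (binom_psum al).

Lemma norm_trig_sum_le (u : nat -> R) N (r : R) : (forall i, `|u i| <= 1) ->
  0 <= r <= 1 -> `|\sum_(i < N) a i * u i * r ^+ i| <= 2.
Proof.
move=> u1 /andP[r0 r1]; apply: le_trans (sum_norm_binom_coef al_gt0 al_lt N).
apply: le_trans (ler_norm_sum _ _ _) _; apply: ler_sum => i _.
rewrite !normrM -mulrA ler_piMr// mulr_ile1 ?u1//.
by rewrite normrX (ger0_norm r0) exprn_ile1.
Qed.

Lemma norm_cos_le1 (x : R) : `|cos x| <= 1.
Proof. by rewrite ler_norml cos_geN1 cos_le1. Qed.

Lemma norm_sin_le1 (x : R) : `|sin x| <= 1.
Proof. by rewrite ler_norml sin_geN1 sin_le1. Qed.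

(** For r <= 1/2 already (1 - r)^2 is large enough; for r >= 1/2 the term
    2 r (1 - cos l) is. *)
Lemma gap_sqr_ge (l r : R) : 0 <= r <= 1 -> (1 - cos l) / 8 <= gap_sqr l r.
Proof.
move=> /andP[r0 r1]; rewrite /gap_sqr.
have := cos_le1 l; have := cos_geN1 l; move: (cos l) => c c1 c2.
rewrite ler_pdivrMr//.
have [h|h] := leP 2^-1 r; nra.
Qed.

Lemma transfer_sqr0 N l : transfer_sqr al N.+1 l 0 = 1.
Proof.
rewrite /transfer_sqr /cos_sum /sin_sum !big_ord_recl !big1 => [|i _|i _]; last 2 first.
- by rewrite lift0 exprS mul0r mulr0.
- by rewrite lift0 exprS mul0r mulr0.
by rewrite /binom_coef big_ord0 !mul0r cos0 sin0 expr0 !mul1r !mulr1 !addr0 expr1n expr0n addr0.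
Qed.

(** Mean value theorem along the radius: the ratio equals 1 at r = 0, and its
    derivative is small because (N + 1) a_(N+1) = - al b_N.  The constant is
    2 for the square times 2 * 3 + 2 * 3 for the two trigonometric factors. *)
Lemma transfer_sqr_error N l : cos l < 1 ->
  `|transfer_sqr al N.+1 l 1 * gap_sqr l 1 `^ (- al) - 1| <=
  24 * (al * b N) * ((1 - cos l) / 8) `^ (- al - 1).
Proof.
move=> c1; have w0 : 0 < (1 - cos l) / 8 by rewrite divr_gt0// subr_gt0.
have wpos (r : R) : r \in `[0, 1] -> 0 < gap_sqr l r.
  by rewrite in_itv => r01; apply: lt_le_trans w0 _; exact: gap_sqr_ge.
pose df r := (- 2 * (N.+1%:R * a N.+1 * r ^+ N) * gap_sqr l r `^ (- al - 1) *
     (cos_sum al N.+1 l r * ((1 - r * cos l) * cos (N.+1%:R * l) -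
        r * sin l * sin (N.+1%:R * l)) +
      sin_sum al N.+1 l r * (r * sin l * cos (N.+1%:R * l) +
        (1 - r * cos l) * sin (N.+1%:R * l)))).
have D (r : R) : r \in `[0, 1] ->
    is_derive r 1 (fun r => transfer_sqr al N.+1 l r * gap_sqr l r `^ (- al)) (df r).
  by move=> h; exact: (@is_derive_ratio R al N.+1 l r (wpos r h)).
have sub (r : R) : r \in `]0, (1 : R)[ -> r \in `[0, (1 : R)].
  by rewrite !in_itv /= => /andP[/ltW -> /ltW ->].
have [|r /sub r01] := @MVT R _ df 0 1 ltr01 (fun r h => D r (sub r h)).
  by apply: derivable_within_continuous => r /D [].
have r01' : 0 <= r <= 1 by rewrite in_itv in r01.
have /andP[r0 r1] := r01'.
have -> : gap_sqr l 0 = 1 by rewrite /gap_sqr mulr0 mul0r expr0n subr0 addr0.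
rewrite transfer_sqr0 powR1 mulr1 subr0 mulr1 => ->.
have eN : N.+1%:R * a N.+1 = - (al * b N).
  by rewrite binom_coefS mulrA mulrN mulrCA divff ?mulr1 ?mulNr// pnatr_eq0.
have z_le : gap_sqr l r `^ (- al - 1) <= ((1 - cos l) / 8) `^ (- al - 1).
  rewrite -opprD !powRN lef_pV2 ?posrE ?powR_gt0 ?wpos//.
  apply: ge0_ler_powR; rewrite ?nnegrE.
  - by rewrite addr_ge0// ltW.
  - exact: ltW.
  - exact/ltW/wpos.
  - exact: gap_sqr_ge.
have abN : 0 <= al * b N by rewrite mulr_ge0 ?(ltW al_gt0) ?(ltW (binom_psum_gt0 _ _ _)).
rewrite /df eN !normrM normrN [leRHS]mulrAC.
have f1 : `|r ^+ N| <= 1 by rewrite normrX (ger0_norm r0) exprn_ile1.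
have tri (p q u v : R) : `|p| <= 2 -> `|q| <= 1 -> `|u| <= 1 -> `|v| <= 1 ->
    `|p * u| + `|q * v| <= 3.
  move=> hp hq hu hv; rewrite !normrM [leRHS](_ : _ = 2 * 1 + 1 * 1); last by ring.
  by rewrite lerD// ler_pM.
have P2 : `|1 - r * cos l| <= 2.
  apply: le_trans (ler_normB _ _) _; rewrite normr1 normrM (ger0_norm r0).
  by rewrite [leRHS](_ : _ = 1 + 1 * 1); [rewrite lerD2l ler_pM ?norm_cos_le1|ring].
have Q1 : `|r * sin l| <= 1.
  by rewrite normrM (ger0_norm r0) mulr_ile1 ?norm_sin_le1.
have f2 : `|cos_sum al N.+1 l r * ((1 - r * cos l) * cos (N.+1%:R * l) -
        r * sin l * sin (N.+1%:R * l)) +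
      sin_sum al N.+1 l r * (r * sin l * cos (N.+1%:R * l) +
        (1 - r * cos l) * sin (N.+1%:R * l))| <= 12.
  apply: le_trans (ler_normD _ _) _; rewrite !normrM.
  rewrite [leRHS](_ : _ = 2 * 3 + 2 * 3); last by ring.
  apply: lerD; apply: ler_pM => //.
  - exact: (norm_trig_sum_le N.+1 (fun i => norm_cos_le1 (i%:R * l)) r01').
  - apply: le_trans (ler_normB _ _) _.
    by apply: tri; rewrite ?norm_cos_le1 ?norm_sin_le1.
  - exact: (norm_trig_sum_le N.+1 (fun i => norm_sin_le1 (i%:R * l)) r01').
  - apply: le_trans (ler_normD _ _) _; rewrite addrC.
    by apply: tri; rewrite ?norm_cos_le1 ?norm_sin_le1.
rewrite normrN (ger0_norm abN) (ger0_norm (powR_ge0 _ _)) (ger0_norm (ler0n _ 2)).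
set z0 := ((1 - cos l) / 8) `^ _.
rewrite [leRHS](_ : _ = 2 * (al * b N * 1) * z0 * 12); last by ring.
have e0 : 0 <= 2 * (al * b N * `|r ^+ N|) :> R by rewrite mulr_ge0// mulr_ge0.
apply: ler_pM => //; first by rewrite mulr_ge0// powR_ge0.
apply: ler_pM => //; first exact: powR_ge0.
by rewrite ler_wpM2l// ler_wpM2l.
Qed.

(** The radial error is proportional to b_N, which tends to 0. *)
Lemma transfer_sqr_cvg l : cos l < 1 ->
  transfer_sqr al N l 1 @[N --> \oo] --> (2 - 2 * cos l) `^ al.
Proof.
move=> c1; have u0 : 0 < 2 - 2 * cos l by lra.
have bE : gap_sqr l 1 = 2 - 2 * cos l by rewrite /gap_sqr; ring.
pose z0 := ((1 - cos l) / 8) `^ (- al - 1).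
have h : transfer_sqr al N.+1 l 1 * gap_sqr l 1 `^ (- al) @[N --> \oo] --> (1 : R).
  have c0 : 24 * al * z0 * b N @[N --> \oo] --> 0.
    rewrite -[X in _ --> X](mulr0 (24 * al * z0)); apply: cvgMr.
    exact: binom_psum_cvg0.
  apply/cvgrPdist_le => e e0; near=> N; rewrite distrC.
  apply: le_trans (transfer_sqr_error N c1) _.
  rewrite [leLHS](_ : _ = 24 * al * z0 * b N); last by rewrite /z0; ring.
  apply: le_trans (ler_norm _) _.
  by near: N; exact: cvgr0_norm_le c0 _ e0.
rewrite -(cvg_shiftS (fun N => transfer_sqr al N l 1)) -bE.
have e N : transfer_sqr al N.+1 l 1 =
    gap_sqr l 1 `^ al * (transfer_sqr al N.+1 l 1 * gap_sqr l 1 `^ (- al)).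
  by rewrite powRN mulrCA divff ?mulr1// gt_eqF// powR_gt0// bE.
have -> : (fun N => transfer_sqr al N.+1 l 1) =
  (fun N => gap_sqr l 1 `^ al * (transfer_sqr al N.+1 l 1 * gap_sqr l 1 `^ (- al))).
  by apply/funext => N; exact: e.
have : gap_sqr l 1 `^ al * (transfer_sqr al N.+1 l 1 * gap_sqr l 1 `^ (- al)) @[N --> \oo] -->
    gap_sqr l 1 `^ al * 1 by exact: cvgMr.
by rewrite mulr1.
Unshelve. all: by end_near. Qed.

End transfer_limit.

(** * Fourier coefficients *)

Section trigonometric_integrals.
Variable R : realType.
Local Notation mu := (@lebesgue_measure R).
Local Notation D := (`[- pi, pi]%classic : set R).

Lemma Npi_lt_pi : - pi < pi :> R.
Proof. by have := pi_gt0 R; lra. Qed.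

Lemma measurable_Npipi : measurable D.
Proof. exact: measurable_itv. Qed.

Lemma mu_Npipi : mu D = (2 * pi)%:E.
Proof.
rewrite lebesgue_measure_itv /= lte_fin Npi_lt_pi -EFinD; congr EFin; ring.
Qed.

Lemma continuous_integrable_Npipi (f : R -> R) : continuous f ->
  mu.-integrable D (EFin \o f).
Proof.
move=> cf; apply: continuous_compact_integrable; first exact: segment_compact.
exact: continuous_subspaceT.
Qed.

Lemma Rintegral_Npipi_FTC (f F : R -> R) : continuous f ->
  (forall x : R, is_derive x 1 F (f x)) ->
  \int[mu]_(x in D) f x = F pi - F (- pi).
Proof.
move=> cf dF; rewrite /Rintegral.
have dF' x : derivable F x 1 by case: (dF x).
have cF : continuous F.
  by move=> x; apply: differentiable_continuous; apply/derivable1_diffP.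
rewrite (continuous_FTC2 Npi_lt_pi _ (F := F)) //.
- exact: continuous_subspaceT.
- split=> //.
  + by apply: cvg_at_right_filter; exact: cF.
  + by apply: cvg_at_left_filter; exact: cF.
- by move=> x _; rewrite derive1E; exact: derive_val.
Qed.

Lemma continuous_cosM (k : R) : continuous (fun l => cos (k * l)).
Proof.
move=> l; apply: continuous_comp; last exact: continuous_cos.
exact: mulrl_continuous.
Qed.

Lemma continuous_sinM (k : R) : continuous (fun l => sin (k * l)).
Proof.
move=> l; apply: continuous_comp; last exact: continuous_sin.
exact: mulrl_continuous.
Qed.

Lemma is_derive_mulrl (k x : R) : is_derive x 1 ( *%R k) k.
Proof.
have -> : *%R k = k \*: (@id R) by [].
by apply: is_derive_eq; exact: mulr1.
Qed.

Lemma sin_intpi (k : int) : sin (k%:~R * pi) = 0 :> R.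
Proof.
have nat0 (n : nat) : sin (n%:R * pi) = 0 :> R.
  elim: n => [|n IH]; first by rewrite mul0r sin0.
  by rewrite -natr1 mulrDl mul1r sinD sinpi mulr0 addr0 IH mul0r.
by case: k => n; [exact: nat0|rewrite NegzE mulrNz mulNr sinN nat0 oppr0].
Qed.

Lemma Rintegral_cos (k : int) :
  \int[mu]_(l in D) cos (k%:~R * l) = 2 * pi * (k == 0)%:R.
Proof.
have [->|k0] := eqVneq k 0.
  under eq_Rintegral do rewrite mul0r cos0.
  rewrite Rintegral_cst; last exact: measurable_Npipi.
  by rewrite mul1r mulr1 [X in fine X]mu_Npipi.
have k0' : k%:~R != 0 :> R by rewrite intr_eq0.
have dF (x : R) : is_derive x 1 (fun l => k%:~R^-1 * sin (k%:~R * l)) (cos (k%:~R * x)).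
have -> : (fun l : R => k%:~R^-1 * sin (k%:~R * l)) =
   (k%:~R^-1 : R) \*: (sin \o *%R k%:~R) by [].
have h := is_derive_mulrl k%:~R x.
by apply: is_derive_eq; rewrite -[LHS]/(k%:~R^-1 * (cos (k%:~R * x) * k%:~R)) mulrC mulfK.
rewrite (Rintegral_Npipi_FTC (@continuous_cosM k%:~R) dF).
by rewrite mulrN sinN sin_intpi oppr0 mulr0 subrr mulr0.
Qed.

Lemma Rintegral_sin (k : int) : \int[mu]_(l in D) sin (k%:~R * l) = 0.
Proof.
have [->|k0] := eqVneq k 0.
  under eq_Rintegral do rewrite mul0r sin0.
  by rewrite Rintegral_cst// mul0r.
have k0' : k%:~R != 0 :> R by rewrite intr_eq0.
have dF (x : R) : is_derive x 1 (fun l => (- k%:~R^-1) * cos (k%:~R * l)) (sin (k%:~R * x)).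
have -> : (fun l : R => (- k%:~R^-1) * cos (k%:~R * l)) =
   (- k%:~R^-1 : R) \*: (cos \o *%R k%:~R) by [].
have h := is_derive_mulrl k%:~R x.
apply: is_derive_eq.
by rewrite -[LHS]/(- k%:~R^-1 * (- sin (k%:~R * x) * k%:~R)) !mulNr mulrN opprK mulrC mulfK.
rewrite (Rintegral_Npipi_FTC (@continuous_sinM k%:~R) dF).
by rewrite mulrN cosN subrr.
Qed.

(** Continuity is proved along, so that the lemma can be iterated on nested
    sums. *)
Lemma Rintegral_Npipi_sum (I : Type) (s : seq I) (F : I -> R -> R) :
  (forall i, continuous (F i)) ->
  continuous (fun l => \sum_(i <- s) F i l) /\
  \int[mu]_(l in D) (\sum_(i <- s) F i l) = \sum_(i <- s) \int[mu]_(l in D) F i l.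
Proof.
move=> cF; elim: s => [|i s [IH1 IH2]].
  split; first by under eq_fun do rewrite big_nil; exact: cst_continuous.
  rewrite big_nil; under eq_Rintegral do rewrite big_nil.
  by rewrite Rintegral_cst ?mul0r.
split.
  under eq_fun do rewrite big_cons.
  by move=> x; apply: continuousD; [exact: cF|exact: IH1].
under eq_Rintegral do rewrite big_cons.
rewrite big_cons -IH2 RintegralD//; exact: continuous_integrable_Npipi.
Qed.

End trigonometric_integrals.

Section spectral_density_limit.
Variables (R : realType) (al : R).
Hypotheses (al_gt0 : 0 < al) (al_lt : al < 2^-1).
Local Notation a := (binom_coef al).
Local Notation mu := (@lebesgue_measure R).
Local Notation D := (`[- pi, pi]%classic : set R).

Lemma transfer_sqr1E N l : transfer_sqr al N l 1 =
  \sum_(p < N) \sum_(q < N) a p * a q * cos (((p : nat)%:Z - (q : nat)%:Z)%:~R * l).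
Proof.
rewrite /transfer_sqr /cos_sum /sin_sum !expr2 !big_distrlr /= -big_split /=.
apply: eq_bigr => p _; rewrite -big_split /=; apply: eq_bigr => q _.
by rewrite !expr1n !mulr1 intrB mulrBl cosB /=; ring.
Qed.

Lemma continuous_transfer_sqr N : continuous (fun l => transfer_sqr al N l 1).
Proof.
have -> : (fun l => transfer_sqr al N l 1) = (fun l => \sum_(p < N) \sum_(q < N)
    a p * a q * cos (((p : nat)%:Z - (q : nat)%:Z)%:~R * l)).
  by apply/funext => l; rewrite transfer_sqr1E.
apply: (proj1 (Rintegral_Npipi_sum _ _)) => p.
apply: (proj1 (Rintegral_Npipi_sum _ _)) => q x.
by apply: cvgMr; exact: continuous_cosM.
Qed.

(** |A_N (e^(il))|^2 is \sum_(p, q) a_p a_q cos ((p - q) l); against cos (h l),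
    orthogonality keeps the terms with p - q = h or p - q = - h, each half of
    an autocovariance of the truncated process. *)
Lemma Rintegral_cos_transfer_sqr N (h : int) :
  \int[mu]_(l in D) (cos (h%:~R * l) * transfer_sqr al N l 1) =
  2 * pi * cdot (yform al N 0) (yform al N h).
Proof.
pose F (p q : 'I_N) (l : R) := 2^-1 * a p * a q *
  cos ((h + (p : nat)%:Z - (q : nat)%:Z)%:~R * l) +
  2^-1 * a p * a q * cos ((h - (p : nat)%:Z + (q : nat)%:Z)%:~R * l).
have cF p q : continuous (F p q).
  by move=> x; apply: cvgD; apply: cvgMr; exact: continuous_cosM.
have IF p q : \int[mu]_(l in D) F p q l =
   pi * (a p * a q * (h + (p : nat)%:Z - (q : nat)%:Z == 0)%:R) +
   pi * (a p * a q * (h - (p : nat)%:Z + (q : nat)%:Z == 0)%:R).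
  have i (c : R) (k : int) : mu.-integrable D (EFin \o (fun l => c * cos (k%:~R * l))).
    apply: continuous_integrable_Npipi => x; apply: cvgMr; exact: continuous_cosM.
  have i' (k : int) : mu.-integrable D (EFin \o (fun l => cos (k%:~R * l))).
    by apply: continuous_integrable_Npipi; exact: continuous_cosM.
  rewrite RintegralD; [|exact: measurable_Npipi|exact: i|exact: i].
  rewrite !RintegralZl; do ?[exact: measurable_Npipi|exact: i'].
  by rewrite !Rintegral_cos; field.
have e l : cos (h%:~R * l) * transfer_sqr al N l 1 = \sum_(p < N) \sum_(q < N) F p q l.
  rewrite transfer_sqr1E mulr_sumr; apply: eq_bigr => p _; rewrite mulr_sumr.
  apply: eq_bigr => q _; rewrite /F.
  have -> : h + (p : nat)%:Z - (q : nat)%:Z = h + ((p : nat)%:Z - (q : nat)%:Z) by lia.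
  have -> : h - (p : nat)%:Z + (q : nat)%:Z = h - ((p : nat)%:Z - (q : nat)%:Z) by lia.
  by move: ((p : nat)%:Z - (q : nat)%:Z) => k; rewrite intrD intrB mulrDl mulrBl cosD cosB; field.
under eq_Rintegral do rewrite e.
have cF1 p : continuous (fun l => \sum_(q < N) F p q l).
  by apply: (proj1 (Rintegral_Npipi_sum _ _)) => q.
rewrite (proj2 (Rintegral_Npipi_sum _ cF1)).
under eq_bigr => p _.
  rewrite (proj2 (Rintegral_Npipi_sum _ (cF p))); under eq_bigr do rewrite IF.
  rewrite big_split /= -!mulr_sumr; over.
rewrite big_split /= -!mulr_sumr [RHS](_ : _ = pi * cdot (yform al N 0) (yform al N h) +
  pi * cdot (yform al N 0) (yform al N h)); last by ring.
rewrite cdot_yform//.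
have e1 : \sum_(p < N) \sum_(q < N) a p * a q *
      (h + (p : nat)%:Z - (q : nat)%:Z == 0)%:R =
    \sum_(p < N) \sum_(q < N) a p * a q *
      (0 + (q : nat)%:Z == h + (p : nat)%:Z)%:R.
  apply: eq_bigr => p _; apply: eq_bigr => q _.
  by congr (_ * (nat_of_bool _)%:R); apply/eqP/eqP; lia.
have e2 : \sum_(p < N) \sum_(q < N) a p * a q *
      (h - (p : nat)%:Z + (q : nat)%:Z == 0)%:R =
    \sum_(p < N) \sum_(q < N) a p * a q *
      (0 + (q : nat)%:Z == h + (p : nat)%:Z)%:R.
  rewrite exchange_big /=.
  apply: eq_bigr => p _; apply: eq_bigr => q _; rewrite [a q * _]mulrC.
  by congr (_ * (nat_of_bool _)%:R); apply/eqP/eqP; lia.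
by rewrite e1 e2.
Qed.

Lemma Rintegral_sin_transfer_sqr N (h : int) :
  \int[mu]_(l in D) (sin (h%:~R * l) * transfer_sqr al N l 1) = 0.
Proof.
pose F (p q : 'I_N) (l : R) := 2^-1 * a p * a q *
  sin ((h + (p : nat)%:Z - (q : nat)%:Z)%:~R * l) +
  2^-1 * a p * a q * sin ((h - (p : nat)%:Z + (q : nat)%:Z)%:~R * l).
have cF p q : continuous (F p q).
  by move=> x; apply: cvgD; apply: cvgMr; exact: continuous_sinM.
have IF p q : \int[mu]_(l in D) F p q l = 0.
  have i (c : R) (k : int) : mu.-integrable D (EFin \o (fun l => c * sin (k%:~R * l))).
    apply: continuous_integrable_Npipi => x; apply: cvgMr; exact: continuous_sinM.
  have i' (k : int) : mu.-integrable D (EFin \o (fun l => sin (k%:~R * l))).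
    by apply: continuous_integrable_Npipi; exact: continuous_sinM.
  rewrite RintegralD; [|exact: measurable_Npipi|exact: i|exact: i].
  rewrite !RintegralZl; do ?[exact: measurable_Npipi|exact: i'].
  by rewrite !Rintegral_sin !mulr0 addr0.
have e l : sin (h%:~R * l) * transfer_sqr al N l 1 = \sum_(p < N) \sum_(q < N) F p q l.
  rewrite transfer_sqr1E mulr_sumr; apply: eq_bigr => p _; rewrite mulr_sumr.
  apply: eq_bigr => q _; rewrite /F.
  have -> : h + (p : nat)%:Z - (q : nat)%:Z = h + ((p : nat)%:Z - (q : nat)%:Z) by lia.
  have -> : h - (p : nat)%:Z + (q : nat)%:Z = h - ((p : nat)%:Z - (q : nat)%:Z) by lia.
  by move: ((p : nat)%:Z - (q : nat)%:Z) => k; rewrite intrD intrB mulrDl mulrBl sinD sinB; field.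
under eq_Rintegral do rewrite e.
have cF1 p : continuous (fun l => \sum_(q < N) F p q l).
  by apply: (proj1 (Rintegral_Npipi_sum _ _)) => q.
rewrite (proj2 (Rintegral_Npipi_sum _ cF1)) big1// => p _.
by rewrite (proj2 (Rintegral_Npipi_sum _ (cF p))) big1.
Qed.

End spectral_density_limit.

(** * The spectral density of fractional noise *)

Section fractional_density.
Variables (R : realType) (al : R).
Hypotheses (al_gt0 : 0 < al) (al_lt : al < 2^-1).
Local Notation mu := (@lebesgue_measure R).
Local Notation D := (`[- pi, pi]%classic : set R).

Definition fnoise_density (l : R) : R := (2 * pi)^-1 * (2 - 2 * cos l) `^ al.

Lemma cos_lt1 (l : R) : D l -> l != 0 -> cos l < 1.
Proof.
rewrite /= in_itv /= => /andP[l1 l2] l0.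
have nl : cos `|l| = cos l by have [h|h] := ger0P l; rewrite ?cosN.
have h0 : (0 : R) \in `[0, pi] by rewrite in_itv /= lexx pi_ge0.
have hl : `|l| \in `[0, pi] by rewrite in_itv /= normr_ge0 ler_norml l1 l2.
by rewrite -nl -[ltRHS](cos0 R) ltr_cos// normr_gt0.
Qed.

Lemma transfer_sqr_le N l : `|transfer_sqr al N l 1| <= 8.
Proof.
have r01 : 0 <= (1 : R) <= 1 by rewrite ler01 lexx.
have sq (x : R) : `|x| <= 2 -> x ^+ 2 <= 4.
  move=> x2; rewrite -real_normK ?num_real// [leRHS](_ : _ = 2 ^+ 2); last by ring.
  by rewrite lerXn2r ?nnegrE.
rewrite ger0_norm ?addr_ge0 ?sqr_ge0// [leRHS](_ : _ = 4 + 4); last by ring.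
apply: lerD; apply: sq.
  exact: (norm_trig_sum_le al_gt0 al_lt N (fun i => norm_cos_le1 (i%:R * l)) r01).
exact: (norm_trig_sum_le al_gt0 al_lt N (fun i => norm_sin_le1 (i%:R * l)) r01).
Qed.

Lemma measurable_fnoise_density : measurable_fun setT fnoise_density.
Proof.
apply: measurable_funM => //; apply: (measurableT_comp (measurable_powR al)).
apply: measurable_funB => //; apply: measurable_funM => //.
by apply: continuous_measurable_fun; exact: continuous_cos.
Qed.

(** Dominated convergence: |A_N|^2 is bounded since the a_i are summable, and it
    converges except at l = 0. *)
Lemma transfer_sqr_density_cvg (g : R -> R) : continuous g -> (forall l, `|g l| <= 1) ->
  mu.-integrable D (fun l => (g l * fnoise_density l)%:E) /\
  (2 * pi)^-1 * \int[mu]_(l in D) (g l * transfer_sqr al N l 1) @[N --> \oo] -->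
    \int[mu]_(l in D) (g l * fnoise_density l).
Proof.
move=> cg g1.
have mD : measurable D by exact: measurable_itv.
have mg : measurable_fun setT g by exact: continuous_measurable_fun.
pose f_ N l := ((2 * pi)^-1 * (g l * transfer_sqr al N l 1))%:E.
pose f l := (g l * fnoise_density l)%:E.
have ct N : continuous (fun l => g l * transfer_sqr al N l 1).
  by move=> x; apply: cvgM; [exact: cg|exact: continuous_transfer_sqr].
have mf_ N : measurable_fun D (f_ N).
  apply/measurable_EFinP; apply: measurable_funTS; apply: measurable_funM => //.
  exact: continuous_measurable_fun.
have mf : measurable_fun D f.
  apply/measurable_EFinP; apply: measurable_funTS; apply: measurable_funM => //.
  exact: measurable_fnoise_density.
have cf : {ae mu, forall l, D l -> f_ N l @[N --> \oo] --> f l}.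
  exists [set 0]; split => //; first exact: lebesgue_measure_set1.
  move=> l /=; apply: contra_notP => l0 Dl; apply: cvg_EFin; first exact: nearW.
  have c := transfer_sqr_cvg al_gt0 al_lt (cos_lt1 Dl (introN eqP l0)).
  have -> : g l * fnoise_density l = (2 * pi)^-1 * (g l * (2 - 2 * cos l) `^ al).
    by rewrite /fnoise_density; ring.
  by apply: cvgMr; apply: cvgMr.
have p0 : 0 < (2 * pi)^-1 :> R by rewrite invr_gt0 mulr_gt0// pi_gt0.
have b8 : mu.-integrable D (EFin \o cst ((2 * pi)^-1 * 8)).
  by apply: continuous_integrable_Npipi; exact: cst_continuous.
have fb : {ae mu, forall l N, D l -> (`|f_ N l| <= ((2 * pi)^-1 * 8)%:E)%E}.
  apply: aeW => l N _; rewrite abse_EFin lee_fin !normrM (gtr0_norm p0) ler_pM2l//.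
  by rewrite [leRHS](_ : _ = 1 * 8); [rewrite ler_pM ?transfer_sqr_le|ring].
have [i1 _ i3] := @dominated_convergence _ _ R mu D mD f_ f _ mf_ mf cf b8 fb.
split=> //.
have -> : (fun N => (2 * pi)^-1 * \int[mu]_(l in D) (g l * transfer_sqr al N l 1)) =
   (fun N => \int[mu]_(l in D) ((2 * pi)^-1 * (g l * transfer_sqr al N l 1))).
  by apply/funext => N; rewrite RintegralZl//; exact: continuous_integrable_Npipi.
by apply: fine_cvg; rewrite fineK//; exact: integrable_fin_num.
Qed.

Lemma fnoise_density_ge0 l : 0 <= fnoise_density l.
Proof. by rewrite mulr_ge0 ?powR_ge0// invr_ge0 mulr_ge0// pi_ge0. Qed.

Lemma integrable_fnoise_density : mu.-integrable D (EFin \o fnoise_density).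
Proof.
have [+ _] := transfer_sqr_density_cvg (@cst_continuous R R 1)
  (fun=> eq_ind_r (fun x => x <= 1) (lexx 1) (normr1 R)).
by apply: eq_integrable => // l _; rewrite /= mul1r.
Qed.

Lemma fnoise_density_sin (h : int) :
  \int[mu]_(l in D) (sin (h%:~R * l) * fnoise_density l) = 0.
Proof.
have [_ c] := transfer_sqr_density_cvg (@continuous_sinM R h%:~R)
  (fun l => norm_sin_le1 (h%:~R * l)).
apply/(cvg_unique _ c) => //.
have -> : (fun N => (2 * pi)^-1 * \int[mu]_(l in D) (sin (h%:~R * l) * transfer_sqr al N l 1)) =
   (fun=> 0) by apply/funext => N; rewrite Rintegral_sin_transfer_sqr// mulr0.
exact: cvg_cst.
Qed.

Lemma fnoise_density_cos (h : int) :
  cdot (yform al N 0) (yform al N h) @[N --> \oo] -->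
  \int[mu]_(l in D) (cos (h%:~R * l) * fnoise_density l).
Proof.
have [_ c] := transfer_sqr_density_cvg (@continuous_cosM R h%:~R)
  (fun l => norm_cos_le1 (h%:~R * l)).
have -> : (fun N => cdot (yform al N 0) (yform al N h)) =
  (fun N => (2 * pi)^-1 * \int[mu]_(l in D) (cos (h%:~R * l) * transfer_sqr al N l 1)) => //.
apply/funext => N; rewrite Rintegral_cos_transfer_sqr// mulKf// gt_eqF// mulr_gt0//.
exact: pi_gt0.
Qed.

Lemma cvg_sin_ratio : sin x / x @[x --> (0 : R)^'] --> (1 : R).
Proof.
have [+ d0] := is_derive_sin (0 : R).
rewrite /derivable; move: d0; rewrite /derive cos0 => d0 c.
have {c} : (fun h => h^-1 *: ((sin \o shift (0 : R)) (h *: (1 : R)) - sin 0)) @ 0^' --> (1 : R).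
  by rewrite -[X in _ --> X]d0.
apply: cvg_trans; apply: near_eq_cvg; near=> x.
by rewrite /= sin0 subr0 addr0 -[x *: 1]/(x * 1) mulr1 -[LHS]/(x^-1 * sin x) mulrC.
Unshelve. all: by end_near. Qed.

(** 2 - 2 cos l = l^2 q (l) with q (l) = 2 (sin l / l)^2 / (1 + cos l), and q tends
    to 1 at 0. *)
Lemma fnoise_density_equiv :
  fnoise_density ~_((0 : R)^') (fun l => (2 * pi)^-1 * `|l| `^ (2 * al)).
Proof.
apply/eqaddoP => e e0.
pose q l : R := 2 * (sin l / l) ^+ 2 / (1 + cos l).
have cc : cos l @[l --> (0 : R)^'] --> (1 : R).
  rewrite -(cos0 R); apply: cvg_within_filter; exact: continuous_cos.
have cq : q l @[l --> (0 : R)^'] --> (1 : R).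
  have -> : (1 : R) = 2 * 1 ^+ 2 / (1 + 1) by field.
  apply: cvgM.
    apply: cvgMr; rewrite !expr2; apply: cvgM; exact: cvg_sin_ratio.
  apply: cvgV; first by rewrite gt_eqF.
  by apply: cvgD; [exact: cvg_cst|].
have cp : q l `^ al @[l --> (0 : R)^'] --> (1 : R).
  have cpow : {for (1 : R), continuous (@powR R ^~ al)}.
    apply: differentiable_continuous; apply/derivable1_diffP.
    by apply: derivable_powR; rewrite in_itv /= ltr01.
  have -> : (1 : R) = 1 `^ al by rewrite powR1.
  exact: (cvg_comp q (@powR R ^~ al) cq cpow).
have /cvgrPdist_le/(_ e e0) cpe := cp.
near=> l.
have l0 : l != 0 by near: l; exact: nbhs_dnbhs_neq.
have c1 : 0 < 1 + cos l.
  have : 0 < cos l by near: l; exact: (cvgr_gt _ cc _ ltr01).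
  lra.
have eq1 : 2 - 2 * cos l = l ^+ 2 * q l.
  rewrite /q; have s2 := sin2cos2 l.
  have -> : l ^+ 2 * (2 * (sin l / l) ^+ 2 / (1 + cos l)) = 2 * sin l ^+ 2 / (1 + cos l).
    by field; rewrite l0 gt_eqF.
  by rewrite s2; field; rewrite gt_eqF.
have q0 : 0 <= q l.
  by rewrite mulr_ge0 ?invr_ge0 ?(ltW c1)// mulr_ge0// sqr_ge0.
have l2 : (l ^+ 2) `^ al = `|l| `^ (2 * al).
  by rewrite powRrM powR_mulrn ?normr_ge0// real_normK ?num_real.
have fE : fnoise_density l = (2 * pi)^-1 * `|l| `^ (2 * al) * q l `^ al.
  by rewrite /fnoise_density eq1 powRM ?sqr_ge0// l2 mulrA.
have qe : `|1 - q l `^ al| <= e.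
  by near: l; exact: cpe.
rewrite !fctE fE -[X in _ - X]mulr1 -mulrBr normrM mulrC distrC.
by rewrite ler_wpM2r.
Unshelve. all: by end_near. Qed.

End fractional_density.

(** The autocovariances of the truncated processes converge both to those of Y
    and to the Fourier coefficients of the density. *)
Lemma spectral_density_Y (R : realType) (disp : measure_display)
    (T : measurableType disp) (P : probability T R) (al : R)
    (eps Y : int -> {RV P >-> R}) :
  0 < al -> al < 2^-1 ->
  mutually_independent P eps -> identically_distributed P eps ->
  (forall i, ('E_P[eps i] = 0)%E) -> (forall i, ('V_P[eps i] = 1)%E) ->
  ('E_P[fun w => (eps 1 w ^+ 4)%R] < +oo)%E ->
  linear_process P (binom_coef al) eps Y ->
  spectral_density P Y (fnoise_density al).
Proof.
move=> al0 al1 ind idd mean var m4 Yd; split.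
- by move=> l _; exact: fnoise_density_ge0.
- exact: integrable_fnoise_density.
- move=> h; rewrite (covariance_Y al0 al1 ind idd mean var m4 Yd); congr EFin.
  have c1 := @cvg_covY _ _ _ _ _ _ al0 al1 ind idd mean var m4 _ Yd 0 h.
  by apply/(cvg_unique _ c1) => //; exact: fnoise_density_cos.
- by move=> h; exact: fnoise_density_sin.
Qed.

(** * Memory of the squared process *)

Theorem theorem3p1 (R : realType) (disp : measure_display)
    (T : measurableType disp) (P : probability T R) (d : R)
    (eps Y : int -> {RV P >-> R}) (X : nat -> T -> R)
    (d_gt : 2^-1 < d) (d_lt : d < 1)
    (eps_indep : mutually_independent P eps)
    (eps_id : identically_distributed P eps)
    (eps_mean : forall i, ('E_P[eps i] = 0)%E)
    (eps_var : forall i, ('V_P[eps i] = 1)%E)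
    (eps_4 : ('E_P[fun w => (eps 1 w ^+ 4)%R] < +oo)%E)
    (Y_def : linear_process P (frac_coef d) eps Y)
    (X_0 : forall w, X 0%N w = 0)
    (X_def : forall n w, X n w = X 0%N w + \sum_(1 <= j < n.+1) Y j%:Z w) :
  asymptotically_LM P d (fun n w => X n w ^+ 2).
Proof.
have al0 : 0 < 1 - d by lra.
have al1 : 1 - d < 2^-1 by lra.
have aE : frac_coef d = binom_coef (1 - d).
  by apply/funext => k; exact: frac_coefE.
rewrite aE in Y_def.
have diffE (n : nat) :
    Defs.first_diff (fun (n : nat) (w : T) => X n w ^+ 2) n = prodYS Y n.
  apply/funext => w; rewrite /Defs.first_diff /prodYS /psumY2.
  have XE k : X k w = psumY Y k w by rewrite X_def X_0 add0r.
  rewrite !XE; case: n => [|n] /=; last by rewrite psumYS; ring.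
  by rewrite /psumY big_geq//; ring.
split.
  move=> n; rewrite diffE.
  exact: (Lfun_prodYS al0 al1 eps_indep eps_id eps_mean eps_var eps_4 Y_def).
exists (fun h => covY Y 0 h%:Z / covY Y 0 0); split.
  move=> h.
  have -> : (fun n => corr P (Defs.first_diff (fun n w => X n w ^+ 2) n)
      (Defs.first_diff (fun n w => X n w ^+ 2) (n + h)%N)) =
    (fun n => corr P (prodYS Y n) (prodYS Y (n + h)%N)).
    by apply/funext => n; rewrite !diffE.
  exact: (corr_prodYS_cvg al0 al1 eps_indep eps_id eps_mean eps_var eps_4 Y_def).
(* the increments of X themselves have the limiting autocorrelation *)
exists disp, T, P, (fun j => Y j : T -> R); split; last first.
  by move=> h; rewrite (corr_Y al0 al1 eps_indep eps_id eps_mean eps_var eps_4 Y_def).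
split; first by lra.
- exact: (stationary_Y al0 al1 eps_indep eps_id eps_mean eps_var eps_4 Y_def).
exists (fnoise_density (1 - d)); first exact: (spectral_density_Y al0 al1 eps_indep).
exists (2 * pi)^-1; first by rewrite invr_gt0 mulr_gt0// pi_gt0.
have := fnoise_density_equiv (1 - d).
rewrite (_ : - (2 * (d - 1)) = 2 * (1 - d))//; ring.
Qed.
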